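(* Let $\Bbbk$ be a field. The restriction map $\rho:\widehat{\mathsf{ONC}}_n\to\operatorname{End}_\Bbbk(V_n)$, sending an operator on $\mathsf{SPol}_n$ in $\widehat{\mathsf{ONC}}_n$ to its restriction to $V_n\subset\mathsf{SPol}_n$, is an isomorphism of algebras.
   Context: $\mathsf{SPol}_n=\Bbbk\langle x_1,\dots,x_n\rangle/\langle x_ix_j+x_jx_i=0 \text{ for } i\ne j\rangle$ is the ring of skew polynomials. For $1\le i\le n-1$ let $s_i$ be the algebra automorphism with $s_i(x_i)=-x_{i+1}$, $s_i(x_{i+1})=-x_i$, $s_i(x_j)=-x_j$ for $j\ne i,i+1$. The odd divided difference operator $\partial_i$ is the $\Bbbk$-linear operator on $\mathsf{SPol}_n$ characterized by $\partial_i(x_j)=1$ for $j=i,i+1$, $\partial_i(x_j)=0$ for $j\neq i,i+1$, and $\partial_i(fg)=\partial_i(f)g+s_i(f)\partial_i(g)$. The negative odd divided difference operator is $\partial_i^-:=x_i\partial_ix_{i+1}$, i.e. $\partial_i^-(f)=x_i\partial_i(x_{i+1}f)$. $\widehat{\mathsf{ONC}}_n$ is the (unital) subalgebra of $\operatorname{End}_\Bbbk(\mathsf{SPol}_n)$ generated by $\partial_1,\dots,\partial_{n-1},\partial_1^-,\dots,\partial_{n-1}^-$. $V_n\subset\mathsf{SPol}_n$ is the subspace with basis the monomials $x_1^{a_1}\cdots x_{n-1}^{a_{n-1}}$ with $0\le a_i\le n-i$; it is stable under all $\partial_i$ and $\partial_i^-$. *)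

(* Defs.v *)
From HB Require Import structures.
From mathcomp Require Import all_boot all_algebra perm.
From mathcomp Require Import boolp.
From mathcomp Require Import finmap.
From mathcomp.multinomials Require Import monalg.

Set Implicit Arguments.
Unset Strict Implicit.
Unset Printing Implicit Defensive.

Import GRing.Theory.
Local Open Scope ring_scope.
Local Open Scope quotient_scope.

(* MathComp's algebras are non-trivial rings, so End_k(V) is an algebra only
   for V != 0. *)
HB.mixin Record hasNonzero (k : fieldType) V of GRing.Lmodule k V := {
  nonzero_subproof : exists v : V, v != 0
}.
#[short(type="nzLmodType")]
HB.structure Definition NzLmodule (k : fieldType) :=
  {V of GRing.Lmodule k V & hasNonzero k V}.

Lemma linear_map_eq (k : fieldType) (U V : lmodType k)
  (f g : {linear U -> V}) : f =1 g -> f = g.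
Proof.
case: f g => [f cf] [g cg] /= /funext fg; case: _ / fg in cg *.
congr GRing.Linear.Pack; case: cf cg => [[aD] [aZ]] [[bD] [bZ]].
by rewrite (Prop_irrelevance aD bD) (Prop_irrelevance aZ bZ).
Qed.

Section LinearOf.
Variables (k : fieldType) (U V : lmodType k) (f : U -> V) (lf : linear f).
Let f' := f.
HB.instance Definition _ := GRing.isLinear.Build k U V *:%R f' lf.
Definition linear_of : {linear U -> V} := f'.
End LinearOf.

Definition endo (k : fieldType) (V : nzLmodType k) : Type := {linear V -> V}.

Section Endo.
Variables (k : fieldType) (V : nzLmodType k).
Implicit Types f g h : endo V.

HB.instance Definition _ := gen_eqMixin (endo V).
HB.instance Definition _ := gen_choiceMixin (endo V).

Lemma endo_scale_linear (c : k) f : linear (fun v => c *: f v).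
Proof.
by move=> a u v; rewrite linearP scalerDr !scalerA mulrC.
Qed.

Definition endo_zero : endo V := \0%R : {linear V -> V}.
Definition endo_opp f : endo V := \- f : {linear V -> V}.
Definition endo_add f g : endo V := f \+ g : {linear V -> V}.
Definition endo_scale (c : k) f : endo V := linear_of (endo_scale_linear c f).
Definition endo_one : endo V := idfun : {linear V -> V}.
Definition endo_mul f g : endo V := f \o g : {linear V -> V}.

Fact endo_addA : associative endo_add.
Proof. by move=> f g h; apply: linear_map_eq => v /=; rewrite addrA. Qed.
Fact endo_addC : commutative endo_add.
Proof. by move=> f g; apply: linear_map_eq => v /=; rewrite addrC. Qed.
Fact endo_add0 : left_id endo_zero endo_add.
Proof. by move=> f; apply: linear_map_eq => v /=; rewrite add0r. Qed.
Fact endo_addN : left_inverse endo_zero endo_opp endo_add.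
Proof. by move=> f; apply: linear_map_eq => v /=; rewrite addNr. Qed.
HB.instance Definition _ := GRing.isZmodule.Build (endo V)
  endo_addA endo_addC endo_add0 endo_addN.

Fact endo_mulA : associative endo_mul.
Proof. by move=> f g h; apply: linear_map_eq. Qed.
Fact endo_mul1 : left_id endo_one endo_mul.
Proof. by move=> f; apply: linear_map_eq. Qed.
Fact endo_mulr1 : right_id endo_one endo_mul.
Proof. by move=> f; apply: linear_map_eq. Qed.
Fact endo_mulDl : left_distributive endo_mul endo_add.
Proof. by move=> f g h; apply: linear_map_eq. Qed.
Fact endo_mulDr : right_distributive endo_mul endo_add.
Proof. by move=> f g h; apply: linear_map_eq => v /=; rewrite linearD. Qed.
Fact endo_oner_neq0 : endo_one != 0.
Proof.
have [v v0] := @nonzero_subproof k V; apply: contra_neq v0 => E.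
by rewrite -[v]/(endo_one v) E.
Qed.
HB.instance Definition _ := GRing.Zmodule_isNzRing.Build (endo V)
  endo_mulA endo_mul1 endo_mulr1 endo_mulDl endo_mulDr endo_oner_neq0.

Fact endo_scaleA a b f : endo_scale a (endo_scale b f) = endo_scale (a * b) f.
Proof. by apply: linear_map_eq => v /=; rewrite scalerA. Qed.
Fact endo_scale1 : left_id 1 endo_scale.
Proof. by move=> f; apply: linear_map_eq => v /=; rewrite scale1r. Qed.
Fact endo_scaleDr : right_distributive endo_scale +%R.
Proof. by move=> c f g; apply: linear_map_eq => v /=; rewrite scalerDr. Qed.
Fact endo_scaleDl f : {morph endo_scale^~ f : a b / a + b}.
Proof. by move=> a b; apply: linear_map_eq => v /=; rewrite scalerDl. Qed.
HB.instance Definition _ := GRing.Zmodule_isLmodule.Build k (endo V)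
  endo_scaleA endo_scale1 endo_scaleDr endo_scaleDl.

Fact endo_scaleAl (c : k) f g : c *: (f * g) = (c *: f) * g.
Proof. by apply: linear_map_eq. Qed.
HB.instance Definition _ :=
  GRing.Lmodule_isLalgebra.Build k (endo V) endo_scaleAl.
Fact endo_scaleAr (c : k) f g : c *: (f * g) = f * (c *: g).
Proof. by apply: linear_map_eq => v /=; rewrite linearZ. Qed.
HB.instance Definition _ :=
  GRing.Lalgebra_isAlgebra.Build k (endo V) endo_scaleAr.

Lemma endo_mulE f g v : (f * g) v = f (g v). Proof. by []. Qed.
Lemma endo_oneE v : (1 : endo V) v = v. Proof. by []. Qed.
Lemma endo_addE f g v : (f + g) v = f v + g v. Proof. by []. Qed.
Lemma endo_scaleE c f v : (c *: f) v = c *: f v. Proof. by []. Qed.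

End Endo.

Inductive gen_subalg (k : fieldType) (A : algType k) (X : A -> Prop)
  : A -> Prop :=
| gen_subalg_gen a of X a : gen_subalg X a
| gen_subalg_one : gen_subalg X 1
| gen_subalg_lin c a b of gen_subalg X a & gen_subalg X b :
    gen_subalg X (c *: a + b)
| gen_subalg_mul a b of gen_subalg X a & gen_subalg X b :
    gen_subalg X (a * b).

Inductive gen_submod (k : fieldType) (V : lmodType k) (X : V -> Prop)
  : V -> Prop :=
| gen_submod_gen v of X v : gen_submod X v
| gen_submod_zero : gen_submod X 0
| gen_submod_lin c u v of gen_submod X u & gen_submod X v :
    gen_submod X (c *: u + v).

Inductive gen_ideal (R : nzRingType) (X : R -> Prop) : R -> Prop :=
| gen_ideal_gen a of X a : gen_ideal X a
| gen_ideal_zero : gen_ideal X 0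
| gen_ideal_add a b of gen_ideal X a & gen_ideal X b : gen_ideal X (a + b)
| gen_ideal_mull r a of gen_ideal X a : gen_ideal X (r * a)
| gen_ideal_mulr r a of gen_ideal X a : gen_ideal X (a * r).

HB.mixin Record isTwoSidedIdeal (R : nzRingType) (S : R -> bool) := {
  ideal_mull_subproof : forall r a, a \in S -> r * a \in S;
  ideal_mulr_subproof : forall r a, a \in S -> a * r \in S;
  ideal_one_subproof : 1 \notin S
}.
#[short(type="twoSidedIdeal")]
HB.structure Definition TwoSidedIdeal (R : nzRingType) :=
  {S of isTwoSidedIdeal R S & GRing.ZmodClosed R S}.

Definition alg_quot (k : fieldType) (A : algType k) (I : twoSidedIdeal A)
  : Type := {ideal_quot I}.
HB.instance Definition _ (k : fieldType) (A : algType k)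
  (I : twoSidedIdeal A) := GRing.Zmodule.on (alg_quot I).
HB.instance Definition _ (k : fieldType) (A : algType k)
  (I : twoSidedIdeal A) := EqQuotient.on (alg_quot I).

Definition quot_pi (k : fieldType) (A : algType k) (I : twoSidedIdeal A)
  (a : A) : alg_quot I := \pi_(alg_quot I) a.

HB.lock Definition quot_mul (k : fieldType) (A : algType k)
  (I : twoSidedIdeal A) (x y : alg_quot I) : alg_quot I :=
  quot_pi I (repr x * repr y).
HB.lock Definition quot_scale (k : fieldType) (A : algType k)
  (I : twoSidedIdeal A) (c : k) (x : alg_quot I) : alg_quot I :=
  quot_pi I (c *: repr x).

Section AlgebraQuotient.
Variables (k : fieldType) (A : algType k) (I : twoSidedIdeal A).
Local Notation Q := (alg_quot I).
Local Notation pi := (quot_pi I).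
Implicit Types (a b : A) (x y : Q).

Lemma ideal_mull r a : a \in I -> r * a \in I.
Proof. exact: ideal_mull_subproof. Qed.
Lemma ideal_mulr r a : a \in I -> a * r \in I.
Proof. exact: ideal_mulr_subproof. Qed.
Lemma ideal_one : 1 \notin I.
Proof. exact: ideal_one_subproof. Qed.

Lemma quot_piP a b : reflect (pi a = pi b) (a - b \in I).
Proof. by rewrite Quotient.idealrBE; exact: eqP. Qed.

Lemma quot_reprK x : pi (repr x) = x. Proof. exact: reprK. Qed.

Lemma quot_pi_ind (P : Q -> Prop) : (forall a, P (pi a)) -> forall x, P x.
Proof. by move=> Ppi x; rewrite -[x]quot_reprK. Qed.

Lemma quot_repr_pi a : repr (pi a) - a \in I.
Proof. by apply/quot_piP; rewrite quot_reprK. Qed.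

Fact quot_pi_zmod_morphism : zmod_morphism pi.
Proof. by move=> a b; exact: (raddfB \pi_Q). Qed.
HB.instance Definition _ :=
  GRing.isZmodMorphism.Build A Q pi quot_pi_zmod_morphism.

Lemma quot_pi_eq0 a : (pi a == 0) = (a \in I).
Proof. by rewrite -(raddf0 pi) -[in RHS](subr0 a); apply/eqP/quot_piP. Qed.

Lemma quot_mul_pi a b : quot_mul (pi a) (pi b) = pi (a * b).
Proof.
rewrite quot_mul.unlock; apply/quot_piP.
move: (quot_repr_pi a) (quot_repr_pi b); move: (repr _) (repr _) => b' a' Ha Hb.
have -> : a' * b' - a * b = (a' - a) * b' + a * (b' - b).
  by rewrite mulrBl mulrBr addrA subrK.
by apply: rpredD; [apply: ideal_mulr | apply: ideal_mull].
Qed.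

Lemma quot_scale_pi c a : quot_scale c (pi a) = pi (c *: a).
Proof.
rewrite quot_scale.unlock; apply/quot_piP; rewrite -scalerBr -mulr_algl.
exact/ideal_mull/quot_repr_pi.
Qed.

Fact quot_mulA : associative (@quot_mul k A I).
Proof.
elim/quot_pi_ind=> a; elim/quot_pi_ind=> b; elim/quot_pi_ind=> c.
by rewrite !quot_mul_pi mulrA.
Qed.
Fact quot_mul1 : left_id (pi 1) (@quot_mul k A I).
Proof. by elim/quot_pi_ind=> a; rewrite quot_mul_pi mul1r. Qed.
Fact quot_mulr1 : right_id (pi 1) (@quot_mul k A I).
Proof. by elim/quot_pi_ind=> a; rewrite quot_mul_pi mulr1. Qed.
Fact quot_mulDl : left_distributive (@quot_mul k A I) +%R.
Proof.
elim/quot_pi_ind=> a; elim/quot_pi_ind=> b; elim/quot_pi_ind=> c.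
by rewrite -raddfD !quot_mul_pi mulrDl raddfD.
Qed.
Fact quot_mulDr : right_distributive (@quot_mul k A I) +%R.
Proof.
elim/quot_pi_ind=> a; elim/quot_pi_ind=> b; elim/quot_pi_ind=> c.
by rewrite -raddfD !quot_mul_pi mulrDr raddfD.
Qed.
Fact quot_oner_neq0 : pi 1 != 0.
Proof. by rewrite quot_pi_eq0 ideal_one. Qed.
HB.instance Definition _ := GRing.Zmodule_isNzRing.Build Q
  quot_mulA quot_mul1 quot_mulr1 quot_mulDl quot_mulDr quot_oner_neq0.

Fact quot_scaleA (c d : k) x :
  quot_scale c (quot_scale d x) = quot_scale (c * d) x.
Proof. by elim/quot_pi_ind: x => f; rewrite !quot_scale_pi scalerA. Qed.
Fact quot_scale1 : left_id 1 (@quot_scale k A I).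
Proof. by elim/quot_pi_ind=> a; rewrite quot_scale_pi scale1r. Qed.
Fact quot_scaleDr : right_distributive (@quot_scale k A I) +%R.
Proof.
move=> c; elim/quot_pi_ind=> a; elim/quot_pi_ind=> b.
by rewrite -raddfD !quot_scale_pi scalerDr raddfD.
Qed.
Fact quot_scaleDl x : {morph (@quot_scale k A I)^~ x : c d / c + d}.
Proof.
by elim/quot_pi_ind: x => f a b; rewrite !quot_scale_pi scalerDl raddfD.
Qed.
HB.instance Definition _ := GRing.Zmodule_isLmodule.Build k Q
  quot_scaleA quot_scale1 quot_scaleDr quot_scaleDl.

Fact quot_pi_monoid_morphism : monoid_morphism pi.
Proof. by split=> [|a b]; [|exact/esym/quot_mul_pi]. Qed.
HB.instance Definition _ :=
  GRing.isMonoidMorphism.Build A Q pi quot_pi_monoid_morphism.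
Fact quot_pi_scalable : scalable pi.
Proof. by move=> c a; exact/esym/quot_scale_pi. Qed.
HB.instance Definition _ :=
  GRing.isScalable.Build k A Q *:%R pi quot_pi_scalable.

Fact quot_scaleAl (c : k) (x y : Q) : c *: (x * y) = (c *: x) * y.
Proof.
elim/quot_pi_ind: x => a; elim/quot_pi_ind: y => b.
by rewrite -(rmorphM pi) -!(linearZZ pi) -(rmorphM pi) scalerAl.
Qed.
HB.instance Definition _ := GRing.Lmodule_isLalgebra.Build k Q quot_scaleAl.
Fact quot_scaleAr (c : k) (x y : Q) : c *: (x * y) = x * (c *: y).
Proof.
elim/quot_pi_ind: x => a; elim/quot_pi_ind: y => b.
by rewrite -(rmorphM pi) -!(linearZZ pi) -(rmorphM pi) scalerAr.
Qed.
HB.instance Definition _ := GRing.Lalgebra_isAlgebra.Build k Q quot_scaleAr.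

Lemma quot_lift (V : lmodType k) (g : {linear A -> V}) :
    (forall a, a \in I -> g a = 0) ->
  exists gb : {linear Q -> V}, forall a, gb (pi a) = g a.
Proof.
move=> g0; pose gb (x : Q) := g (repr x).
have gbE a : gb (pi a) = g a.
  by apply/eqP; rewrite -subr_eq0 /gb -linearB g0 // quot_repr_pi.
have lgb : linear gb.
  move=> c; elim/quot_pi_ind=> a; elim/quot_pi_ind=> b.
  by rewrite -linearP !gbE linearP.
by exists (linear_of lgb).
Qed.

End AlgebraQuotient.

Definition gen_ideal_pred (R : nzRingType) (X : R -> Prop) : {pred R} :=
  fun a => `[< gen_ideal X a >].

Fact gen_ideal_zmod_closed (R : nzRingType) (X : R -> Prop) :
  zmod_closed (gen_ideal_pred X).
Proof.
split=> [|f g /asboolP If /asboolP Ig]; apply/asboolP.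
  exact: gen_ideal_zero.
by apply: gen_ideal_add => //; rewrite -mulN1r; apply: gen_ideal_mull.
Qed.

Lemma gen_ideal_pred_mull (R : nzRingType) (X : R -> Prop) r a :
  a \in gen_ideal_pred X -> r * a \in gen_ideal_pred X.
Proof. by move=> /asboolP Ia; apply/asboolP/gen_ideal_mull. Qed.

Lemma gen_ideal_pred_mulr (R : nzRingType) (X : R -> Prop) r a :
  a \in gen_ideal_pred X -> a * r \in gen_ideal_pred X.
Proof. by move=> /asboolP Ia; apply/asboolP/gen_ideal_mulr. Qed.

Lemma gen_ideal_proper (R S : nzRingType) (h : {rmorphism R -> S})
  (X : R -> Prop) : (forall a, X a -> h a = 0) -> 1 \notin gen_ideal_pred X.
Proof.
move=> hX; apply/negP => /asboolP I1; have : h 1 = 0.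
  elim: I1 => [a /hX //||a b _ ha _ hb|r a _ ha|r a _ ha].
  - exact: rmorph0.
  - by rewrite rmorphD /= ha hb addr0.
  - by rewrite rmorphM /= ha mulr0.
  - by rewrite rmorphM /= ha mul0r.
by move/eqP; rewrite rmorph1 oner_eq0.
Qed.

Definition skew_rel (n : nat) (R : nzRingType) (x : 'I_n -> R) (r : R) : Prop :=
  exists i j : 'I_n, i != j /\ r = x i * x j + x j * x i.

Lemma ddiff_rel (n : nat) (R : nzRingType) (y : 'I_n -> R) (p q : 'I_n)
  (e := fun j => ((j == p) || (j == q))%:R : R) (t := tperm p q) i j :
  i != j ->
  e i * y j + - y (t i) * e j + (e j * y i + - y (t j) * e i) = 0.
Proof.
rewrite /e /t !mulr_natl !mulr_natr.
move=> ij; have tF l : (l == p) || (l == q) = false -> tperm p q l = l.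
  by case: tpermP => // [->|->]; rewrite eqxx ?orbT.
case ipq: (_ || _); case jpq: (_ || _) => /=; rewrite ?mulr0n ?mulr1n ?addr0 //.
- have [-> ->] : tperm p q i = j /\ tperm p q j = i.
    case/orP: ipq jpq ij => /eqP-> /orP[]/eqP->; rewrite ?eqxx // => _;
    by rewrite tpermL tpermR.
  by rewrite !subrr addr0.
- by rewrite tF // add0r subrr.
- by rewrite tF // add0r addrC subrr.
Qed.

Lemma skew_rel_ker (n : nat) (R S : nzRingType) (x : 'I_n -> R)
  (h : {rmorphism R -> S}) :
  (forall i, h (x i) = 0) -> forall r, skew_rel x r -> h r = 0.
Proof.
by move=> hx r [i [j [_ ->]]]; rewrite rmorphD !rmorphM /= !hx mulr0 addr0.
Qed.

(* The facts assumed on words hold in the free algebra; A is kept abstract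
   because unification is very slow in the concrete one. *)
Section Presentation.
Variables (k : fieldType) (n : nat) (A : algType k) (x : 'I_n -> A).
Variable word : seq 'I_n -> A.
Hypothesis word_nil : word [::] = 1.
Hypothesis word_cons : forall i w, word (i :: w) = x i * word w.
Hypothesis word_span : forall P : A -> Prop,
  P 0 -> (forall w, P (word w)) ->
  (forall c f g, P f -> P g -> P (c *: f + g)) -> forall f, P f.
Hypothesis word_ext : forall (V : lmodType k) (h : seq 'I_n -> V),
  exists g : {linear A -> V}, forall w, g (word w) = h w.

Lemma word_ind (P : A -> Prop) :
  P 1 -> (forall i f, P f -> P (x i * f)) ->
  (forall c f g, P f -> P g -> P (c *: f + g)) -> forall f, P f.
Proof.
move=> P1 PX PD; apply: word_span => //.
  by rewrite -[0](addNr 1) -scaleN1r; apply: PD.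
by elim=> [|i w IHw]; rewrite ?word_nil // word_cons; apply: PX.
Qed.

Lemma word_rec (V : lmodType k) (v0 : V) (step : 'I_n -> A -> V -> V) :
    (forall i c f g u v,
       step i (c *: f + g) (c *: u + v) = c *: step i f u + step i g v) ->
  exists g : {linear A -> V},
    g 1 = v0 /\ forall i f, g (x i * f) = step i f (g f).
Proof.
move=> lstep; have [g gE] := word_ext (fix h w :=
  if w is i :: w' then step i (word w') (h w') else v0).
exists g; split=> [|i]; first by rewrite -word_nil gE.
apply: word_span => [|w|c f1 f2 IH1 IH2].
- rewrite mulr0 raddf0; have := lstep i (-1) 0 0 0 0.
  by rewrite !scaler0 !addr0 scaleN1r addNr.
- by rewrite -word_cons !gE.
- by rewrite mulrDr -scalerAr !linearP lstep IH1 IH2.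
Qed.

Variable I : twoSidedIdeal A.
Hypothesis I_gen : forall a, reflect (gen_ideal (skew_rel x) a) (a \in I).
Local Notation Q := (alg_quot I).
Local Notation pi := (quot_pi I).

Lemma presentation_ind (P : Q -> Prop) :
  P 1 -> (forall i f, P f -> P (pi (x i) * f)) ->
  (forall c f g, P f -> P g -> P (c *: f + g)) -> forall f, P f.
Proof.
move=> P1 PX PD; elim/quot_pi_ind; elim/word_ind => [|i f Pf|c f g Pf Pg].
- by rewrite rmorph1.
- by rewrite rmorphM; apply: PX.
- by rewrite linearP; apply: PD.
Qed.

Lemma presentation_rel i j : i != j ->
  pi (x i * x j + x j * x i) = 0.
Proof.
move=> ij; apply/eqP; rewrite quot_pi_eq0.
by apply/I_gen/gen_ideal_gen; exists i, j.
Qed.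

Lemma presentation_hom (B : algType k) (y : 'I_n -> B) :
    (forall i j, i != j -> y i * y j + y j * y i = 0) ->
  exists s : {lrmorphism Q -> B}, forall j, s (pi (x j)) = y j.
Proof.
move=> yC; have [|S [S1 SX]] := @word_rec B 1 (fun j _ u => y j * u).
  by move=> i c f g u v; rewrite mulrDr scalerAr.
have SM f g : S (f * g) = S f * S g.
  elim/word_ind: f => [|j f IH|c f1 f2 IH1 IH2].
  - by rewrite mul1r S1 mul1r.
  - by rewrite -mulrA !SX IH mulrA.
  - by rewrite mulrDl -scalerAl !linearP IH1 IH2 mulrDl scalerAl.
have SXE j : S (x j) = y j by rewrite -[x j]mulr1 SX S1 mulr1.
have S0 f : f \in I -> S f = 0.
  move=> /I_gen; elim=> {f} [_ [j [l [jl ->]]]||f g _ f0 _ g0|r f _ f0|r f _ f0].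
  - by rewrite raddfD /= !SM !SXE yC.
  - exact: raddf0.
  - by rewrite raddfD /= f0 g0 addr0.
  - by rewrite SM f0 mulr0.
  - by rewrite SM f0 mul0r.
have [s sE] := quot_lift S0.
have sM : monoid_morphism s.
  split; first by rewrite -[1](rmorph1 pi) sE.
  elim/quot_pi_ind=> f; elim/quot_pi_ind=> g.
  by rewrite -(rmorphM pi) !sE SM.
pose s' : {lrmorphism Q -> B} := HB.pack (s : Q -> B)
  (GRing.Linear.on s) (GRing.isMonoidMorphism.Build Q B s sM).
by exists s' => j; rewrite -SXE -sE.
Qed.

Lemma presentation_derivation (s : {lrmorphism Q -> Q}) (e : 'I_n -> Q) :
    (forall i j, i != j ->
       e i * pi (x j) + s (pi (x i)) * e j
       + (e j * pi (x i) + s (pi (x j)) * e i) = 0) ->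
  exists d : {linear Q -> Q}, (forall j, d (pi (x j)) = e j) /\
    forall f g, d (f * g) = d f * g + s f * d g.
Proof.
move=> eC.
have [|D [D1 DX]] := @word_rec Q 0 (fun j f u => e j * pi f + s (pi (x j)) * u).
  move=> i c f g u v; rewrite linearP !mulrDr -!scalerAr scalerDr.
  by rewrite addrACA.
have DXE j : D (x j) = e j.
  by rewrite -[x j]mulr1 DX D1 mulr0 addr0 rmorph1 mulr1.
have DM f g : D (f * g) = D f * pi g + s (pi f) * D g.
  elim/word_ind: f => [|j f IH|c f1 f2 IH1 IH2].
  - by rewrite mul1r D1 mul0r add0r !rmorph1 mul1r.
  - by rewrite -mulrA !DX IH !rmorphM /= mulrDl mulrDr !mulrA addrA.
  - rewrite mulrDl -scalerAl !linearP IH1 IH2 /= !mulrDl !scalerDr !scalerAl.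
    by rewrite addrACA.
have D0 f : f \in I -> D f = 0.
  suff H : gen_ideal (skew_rel x) f -> pi f = 0 /\ D f = 0.
    by move=> /I_gen/H [].
  elim=> {f} [_ [j [l [jl ->]]]||f g _ [pf f0] _ [pg g0]|r f _ [pf f0]|r f _ [pf f0]].
  - by split; [exact: presentation_rel | rewrite raddfD /= !DM !DXE eC].
  - by rewrite !raddf0.
  - by rewrite !raddfD /= pf pg f0 g0 !addr0.
  - by rewrite rmorphM DM /= pf f0 !mulr0 addr0.
  - by rewrite rmorphM DM /= pf f0 raddf0 !mul0r addr0.
have [d dE] := quot_lift D0.
exists d; split=> [j|]; first by rewrite dE DXE.
elim/quot_pi_ind=> f; elim/quot_pi_ind=> g.
by rewrite -(rmorphM pi) !dE DM.
Qed.

End Presentation.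

Section MonoidAlgebra.
Variables (k : fieldType) (M : monomType).
Local Notation F := {malg k[M]}.

Fact malg_scaleAr (c : k) (f g : F) : c *: (f * g) = f * (c *: g).
Proof.
have mulC : f * c%:MP = c%:MP * f.
  rewrite !malgM_def fgmulgU fgmulUg; apply: eq_bigr => w _.
  by rewrite mulrC mulm1 mul1m.
by rewrite -!mul_malgC !mulrA mulC.
Qed.

Lemma malg_lin_ind (P : F -> Prop) :
  P 0 -> (forall w, P << w >>) ->
  (forall c f g, P f -> P g -> P (c *: f + g)) -> forall f, P f.
Proof.
move=> P0 Pw PD f; rewrite [f]monalgE.
apply: big_ind => // [g h Pg Ph | w _]; first by rewrite -[g]scale1r; apply: PD.
have -> : << f@_w *g w >> = f@_w *: << w >> + 0 :> F.
  by rewrite addr0 -mul_malgC malgM_def fgmulUU mulr1 mul1m.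
exact: PD.
Qed.

Definition lin_ext (V : lmodType k) (h : M -> V) (f : F) : V :=
  \sum_(w <- msupp f) f@_w *: h w.

Lemma lin_extEw (V : lmodType k) (h : M -> V) (d : {fset M}) (f : F) :
  (msupp f `<=` d)%fset -> lin_ext h f = \sum_(w <- d) f@_w *: h w.
Proof.
move=> le; rewrite [LHS](big_fset_incl _ le) => //= x xd /mcoeff_outdom ->.
by rewrite scale0r.
Qed.

Fact lin_ext_linear (V : lmodType k) (h : M -> V) : linear (lin_ext h).
Proof.
move=> c f g; pose d := (msupp f `|` msupp g `|` msupp (c *: f + g))%fset.
have fd : (msupp f `<=` d)%fset by rewrite /d -fsetUA fsubsetUl.
have gd : (msupp g `<=` d)%fset by rewrite /d -fsetUA fsetUCA fsubsetUl.
have hd : (msupp (c *: f + g) `<=` d)%fset by rewrite fsubsetUr.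
rewrite (lin_extEw h fd) (lin_extEw h gd) (lin_extEw h hd).
rewrite scaler_sumr -big_split; apply: eq_bigr => w _.
by rewrite mcoeffD mcoeffZ scalerDl scalerA.
Qed.

Lemma lin_extU (V : lmodType k) (h : M -> V) w : lin_ext h << w >> = h w.
Proof. by rewrite /lin_ext msuppU1 big_seq_fset1 mcoeffUU scale1r. Qed.

End MonoidAlgebra.

Definition free_alg (k : fieldType) (n : nat) : Type := {malg k[{fmonom 'I_n}]}.
HB.instance Definition _ k n := GRing.Lalgebra.on (free_alg k n).
HB.instance Definition _ (k : fieldType) n :=
  GRing.Lalgebra_isAlgebra.Build k (free_alg k n)
    (@malg_scaleAr k {fmonom 'I_n}).

Section FreeAlgebra.
Variables (k : fieldType) (n : nat).
Local Notation F := (free_alg k n).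

Definition fvar (i : 'I_n) : F := << fmu i >>.

Definition fword (w : seq 'I_n) : F := << FMonom w >>.

Lemma fword_nil : fword [::] = 1.
Proof. by congr (<< _ >>); apply/eqP; rewrite fmP fm1. Qed.

Lemma fword_cons i w : fword (i :: w) = fvar i * fword w.
Proof.
rewrite [RHS]malgM_def fgmulUU mulr1; congr (<< _ >>).
by apply/eqP; rewrite fmP fmM fmU.
Qed.

Lemma fword_span (P : F -> Prop) :
  P 0 -> (forall w, P (fword w)) ->
  (forall c f g, P f -> P g -> P (c *: f + g)) -> forall f, P f.
Proof.
move=> P0 Pw PD; apply: malg_lin_ind P0 _ PD; case=> w; exact: Pw.
Qed.

Lemma fword_ext (V : lmodType k) (h : seq 'I_n -> V) :
  exists g : {linear F -> V}, forall w, g (fword w) = h w.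
Proof.
exists (linear_of (lin_ext_linear (fun w : {fmonom 'I_n} => h w))) => w.
exact: lin_extU.
Qed.

Let coef1 : {rmorphism F -> k} := @mcoeff {fmonom 'I_n} k mone.

Fact fvar_coef1 i : coef1 (fvar i) = 0.
Proof.
have -> : coef1 (fvar i) = (fmu i == mone)%:R := mcoeffU1 _ _ _.
by rewrite -fdeg_eq0 fdegU.
Qed.

Definition skew_ideal : {pred F} := gen_ideal_pred (skew_rel fvar).

HB.instance Definition _ :=
  GRing.isZmodClosed.Build F skew_ideal (gen_ideal_zmod_closed (skew_rel fvar)).
HB.instance Definition _ := isTwoSidedIdeal.Build F skew_ideal
  (@gen_ideal_pred_mull F (skew_rel fvar)) (@gen_ideal_pred_mulr F (skew_rel fvar))
  (gen_ideal_proper (h := coef1) (skew_rel_ker fvar_coef1)).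

Definition SPol : Type := alg_quot skew_ideal.
HB.instance Definition _ := GRing.Algebra.on SPol.
HB.instance Definition _ := hasNonzero.Build k SPol
  (ex_intro _ (1 : SPol) (oner_neq0 SPol)).

Lemma skew_idealP a : reflect (gen_ideal (skew_rel fvar) a) (a \in skew_ideal).
Proof. exact: asboolP. Qed.

End FreeAlgebra.

HB.lock Definition svar (k : fieldType) (n : nat) (i : 'I_n) : SPol k n :=
  quot_pi (@skew_ideal k n) (fvar k i).

Section SkewPolynomials.
Variables (k : fieldType) (n : nat).
Local Notation svar := (@svar k n).

Lemma svarE i : svar i = quot_pi (@skew_ideal k n) (fvar k i).
Proof. by rewrite svar.unlock. Qed.

Lemma svar_anticomm i j : i != j -> svar i * svar j + svar j * svar i = 0.
Proof.
move=> ij; rewrite !svarE -!(rmorphM (quot_pi (@skew_ideal k n))).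
rewrite -(rmorphD (quot_pi (@skew_ideal k n))).
exact: (presentation_rel (@skew_idealP k n) ij).
Qed.

Lemma spol_ind (P : SPol k n -> Prop) :
  P 1 -> (forall i f, P f -> P (svar i * f)) ->
  (forall c f g, P f -> P g -> P (c *: f + g)) -> forall f, P f.
Proof.
move=> P1 PX PD; apply: (presentation_ind (@fword_nil k n) (@fword_cons k n)
  (@fword_span k n)) => // i f; rewrite -svarE; exact: PX.
Qed.

Lemma spol_hom (B : algType k) (y : 'I_n -> B) :
    (forall i j, i != j -> y i * y j + y j * y i = 0) ->
  exists s : {lrmorphism SPol k n -> B}, forall j, s (svar j) = y j.
Proof.
move=> yC; have [s sE] := presentation_hom (@fword_nil k n) (@fword_cons k n)
  (@fword_span k n) (@fword_ext k n) (@skew_idealP k n) yC.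
by exists s => j; rewrite svarE sE.
Qed.

Lemma spol_derivation (s : {lrmorphism SPol k n -> SPol k n})
    (e : 'I_n -> SPol k n) :
    (forall i j, i != j ->
       e i * svar j + s (svar i) * e j
       + (e j * svar i + s (svar j) * e i) = 0) ->
  exists d : {linear SPol k n -> SPol k n}, (forall j, d (svar j) = e j) /\
    forall f g, d (f * g) = d f * g + s f * d g.
Proof.
move=> eC; have [|d [dX dM]] := presentation_derivation (@fword_nil k n)
  (@fword_cons k n) (@fword_span k n) (@fword_ext k n) (@skew_idealP k n)
  (s := s) (e := e).
  by move=> i j ij; rewrite -!svarE; exact: eC.
by exists d; split=> // j; rewrite svarE dX.
Qed.

End SkewPolynomials.

Section OddNilHecke.
Variables (k : fieldType) (n : nat).
Local Notation SPol := (SPol k n).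
Local Notation svar := (@svar k n).

(* Variables are indexed from 0: for i < n - 1, lo i = i and hi i = i + 1 index
   the two adjacent variables that the i-th operator acts on. *)
Lemma lo_subproof (i : 'I_n.-1) : (i < n)%N.
Proof. by case: n i => [|m] [i]; last exact: leqW. Qed.
Lemma hi_subproof (i : 'I_n.-1) : (i.+1 < n)%N.
Proof. by case: n i => [|m] []. Qed.
Definition lo (i : 'I_n.-1) : 'I_n := Ordinal (lo_subproof i).
Definition hi (i : 'I_n.-1) : 'I_n := Ordinal (hi_subproof i).

Lemma lo_neq_hi i : lo i != hi i.
Proof. by rewrite -val_eqE /= neq_ltn ltnSn. Qed.

Definition skew_aut_spec (i : 'I_n.-1) (s : {lrmorphism SPol -> SPol}) :=
  [/\ s (svar (lo i)) = - svar (hi i),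
      s (svar (hi i)) = - svar (lo i) &
      forall j, j != lo i -> j != hi i -> s (svar j) = - svar j].

Lemma skew_aut_specP i s : skew_aut_spec i s <->
  forall j, s (svar j) = - svar (tperm (lo i) (hi i) j).
Proof.
split=> [[slo shi sj] j | sE].
  by case: tpermP => [->|->|/eqP jlo /eqP jhi] //; apply: sj.
split=> [||j jlo jhi]; rewrite sE ?tpermL ?tpermR //.
by rewrite tpermD // eq_sym.
Qed.

Lemma lrmorph_spolP (s t : {lrmorphism SPol -> SPol}) :
  (forall j, s (svar j) = t (svar j)) -> s =1 t.
Proof.
move=> st; elim/spol_ind=> [|j f Hf|c f g Hf Hg]; first by rewrite !rmorph1.
  by rewrite !rmorphM /= st Hf.
by rewrite !linearP /= Hf Hg.
Qed.

Lemma skew_aut_exists i : exists s, skew_aut_spec i s.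
Proof.
pose t := tperm (lo i) (hi i).
have [|s sE] := @spol_hom k n SPol (fun j => - svar (t j)).
  by move=> j l jl; rewrite !mulrNN svar_anticomm // (inj_eq perm_inj).
by exists s; apply/skew_aut_specP.
Qed.

Definition skew_aut (i : 'I_n.-1) : {lrmorphism SPol -> SPol} :=
  sval (cid (skew_aut_exists i)).

Lemma skew_autP i : skew_aut_spec i (skew_aut i).
Proof. exact: svalP (cid _). Qed.

Lemma skew_aut_var i j : skew_aut i (svar j) = - svar (tperm (lo i) (hi i) j).
Proof. by move: j; apply/skew_aut_specP/skew_autP. Qed.

Lemma skew_autK i : involutive (skew_aut i).
Proof.
apply: (@lrmorph_spolP (skew_aut i \o skew_aut i) idfun) => j /=.
by rewrite skew_aut_var raddfN /= skew_aut_var opprK tpermK.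
Qed.

Definition odd_ddiff_spec (i : 'I_n.-1) (d : endo SPol) :=
  [/\ forall j, d (svar j) = ((j == lo i) || (j == hi i))%:R &
      forall f g, d (f * g) = d f * g + skew_aut i f * d g].

Lemma odd_ddiff_exists i : exists d, odd_ddiff_spec i d.
Proof.
pose e j : SPol := ((j == lo i) || (j == hi i))%:R.
have [|d [dX dM]] := @spol_derivation k n (skew_aut i) e; last by exists d; split.
by move=> j l jl; rewrite !skew_aut_var; exact: ddiff_rel.
Qed.

Lemma odd_ddiff_uniq i d d' :
  odd_ddiff_spec i d -> odd_ddiff_spec i d' -> d = d'.
Proof.
have d1 e : odd_ddiff_spec i e -> e 1 = 0.
  case=> _ eM; apply/(addrI (e 1)); rewrite addr0.
  by rewrite -{3}[1]mulr1 eM rmorph1 mulr1 mul1r.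
move=> Hd Hd'; apply: linear_map_eq.
elim/spol_ind=> [|j f IH|c f g IH1 IH2].
- by rewrite !d1.
- by case: Hd Hd' => dX dM [dX' dM']; rewrite dM dM' dX dX' IH.
- by rewrite !linearP IH1 IH2.
Qed.

Definition odd_ddiff (i : 'I_n.-1) : endo SPol :=
  sval (cid (odd_ddiff_exists i)).

Lemma odd_ddiffP i : odd_ddiff_spec i (odd_ddiff i).
Proof. exact: svalP (cid _). Qed.

Fact lmul_linear (a : SPol) : linear (fun f => a * f).
Proof. by move=> c f g; rewrite mulrDr scalerAr. Qed.
Definition lmul (a : SPol) : endo SPol := linear_of (lmul_linear a).

Definition neg_odd_ddiff (i : 'I_n.-1) : endo SPol :=
  lmul (svar (lo i)) * odd_ddiff i * lmul (svar (hi i)).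

Lemma neg_odd_ddiffE i f :
  neg_odd_ddiff i f = svar (lo i) * odd_ddiff i (svar (hi i) * f).
Proof. by []. Qed.

Definition onc_gen (f : endo SPol) : Prop :=
  exists i, f = odd_ddiff i \/ f = neg_odd_ddiff i.

Definition onc_subalg : {pred endo SPol} :=
  fun f => `[< gen_subalg onc_gen f >].

Fact onc_subalg_closed : GRing.subalg_closed onc_subalg.
Proof.
split=> [|c f g /asboolP Hf /asboolP Hg|f g /asboolP Hf /asboolP Hg];
  apply/asboolP.
- exact: gen_subalg_one.
- exact: gen_subalg_lin.
- exact: gen_subalg_mul.
Qed.

HB.instance Definition _ :=
  GRing.isSubalgClosed.Build k (endo SPol) onc_subalg onc_subalg_closed.

Record ONC := MkONC { onc_val : endo SPol; _ : onc_val \in onc_subalg }.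
HB.instance Definition _ := [isSub for onc_val].
HB.instance Definition _ := [Choice of ONC by <:].
HB.instance Definition _ := [SubChoice_isSubAlgebra of ONC by <:].

(* Exponents are bounded by n - i for the 1-based index i, hence by n - i.+1
   for the 0-based one. *)
Definition staircase (a : {ffun 'I_n.-1 -> nat}) : bool :=
  [forall i, a i <= n - i.+1]%N.
Definition smonom (a : {ffun 'I_n.-1 -> nat}) : SPol :=
  \prod_(i < n.-1) svar (lo i) ^+ a i.

Definition stair_pred : {pred SPol} := fun f =>
  `[< gen_submod (fun m => exists2 a, staircase a & m = smonom a) f >].

Fact stair_submod_closed : GRing.submod_closed stair_pred.
Proof.
split=> [|c f g /asboolP Hf /asboolP Hg]; apply/asboolP.
  exact: gen_submod_zero.
exact: gen_submod_lin.
Qed.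
HB.instance Definition _ :=
  GRing.isSubmodClosed.Build k SPol stair_pred stair_submod_closed.

Record Vn := MkVn { vn_val : SPol; _ : vn_val \in stair_pred }.
HB.instance Definition _ := [isSub for vn_val].
HB.instance Definition _ := [Choice of Vn by <:].
HB.instance Definition _ := [SubChoice_isSubLmodule of Vn by <:].

Fact stair1 : 1 \in stair_pred.
Proof.
apply/asboolP; have -> : 1 = smonom [ffun=> 0%N].
  by rewrite /smonom big1 // => i _; rewrite ffunE.
apply: gen_submod_gen; exists [ffun=> 0%N] => //.
by apply/forallP => i; rewrite ffunE.
Qed.
Fact vn_nonzero : exists v : Vn, v != 0.
Proof. by exists (MkVn stair1); rewrite -val_eqE /= oner_neq0. Qed.
HB.instance Definition _ := hasNonzero.Build k Vn vn_nonzero.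

End OddNilHecke.

(* Main.v *)
From HB Require Import structures.
Require Import Defs.
From mathcomp Require Import all_boot all_algebra boolp perm zify.

(** Write D_i for the odd divided differences, N_i for the negative ones, and
    call a polynomial odd symmetric when every D_i kills it.

    Stability. Up to sign x_i x_(i+1) passes through D_i, so D_i only produces
    exponents of x_i and x_(i+1) below the larger of the given two
    (ddiff_mon2); this keeps the staircase bounds (onc_stable).

    Injectivity. By the twisted Leibniz rule every operator of the algebra is
    right linear over the odd symmetric polynomials (onc_rlin), so an operator
    that vanishes on the staircase monomials vanishes as soon as these monomials
    generate the skew polynomials as a right module over the odd symmetric ones
    (init_span_full). With y_j = (-1)^j x_j, the ordered elementary polynomials,
    which are the coefficients of the product of the 1 + y_j t for 0 <= j < n,
    are odd symmetric (ddiff_elsym). Since t is central, this product can be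
    divided on the left by 1 + y_0 t, ..., 1 + y_i t, one factor at a time. The
    last quotient is the product of the n - i - 1 remaining factors, so its
    coefficient of t^(n - i) vanishes. This expresses x_i^(n - i) by lower
    powers of x_i with coefficients from the previous quotient (tail_elsym_top), and
    these lie in the span already obtained from x_0, ..., x_(i-1). So all
    exponents of x_i can be reduced to the staircase bound (init_span_closed).

    Surjectivity. The algebra contains operators that act on the staircase
    monomials as all matrix units (matrix_units), by induction from the last
    variable to the first. Suppose that the matrix units for the monomials in
    x_(i+1), x_(i+2), ... are known, let P be the projection to the monomial 1
    among them, and let d be the staircase bound for x_(i+1). Then P D_i lowers
    the exponent of x_i by one (shift_exists). In the other direction, first
    create x_(i+1)^d by a known matrix unit, then apply P N_i: this maps 1 to
    x_i^(d+1) up to sign and kills x_i, ..., x_i^(d+1) (raise_exists).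
    These two operators give all the matrix units in powers of x_i, and the
    known ones take care of the other variables.

    The signs from the earlier variables disappear when monomials are written
    with the variables in decreasing order, because D_j and N_j with i <= j are
    right linear over x_0, ..., x_(i-1). *)

Set Implicit Arguments.
Unset Strict Implicit.
Unset Printing Implicit Defensive.

Import GRing.Theory.
Local Open Scope ring_scope.

(** * Linear spans *)

Section LinearSpan.
Variables (k : fieldType) (U V : lmodType k).
Implicit Types (X Y : V -> Prop).

Lemma span_add X u v : gen_submod X u -> gen_submod X v -> gen_submod X (u + v).
Proof. by move=> Xu Xv; rewrite -[u]scale1r; apply: gen_submod_lin. Qed.

Lemma span_scale X c u : gen_submod X u -> gen_submod X (c *: u).
Proof.
by move=> Xu; rewrite -[_ *: _]addr0; apply/gen_submod_lin/gen_submod_zero.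
Qed.

Lemma span_opp X u : gen_submod X u -> gen_submod X (- u).
Proof. by rewrite -scaleN1r; apply: span_scale. Qed.

Lemma span_sum X (I : Type) (r : seq I) (P : pred I) (F : I -> V) :
  (forall i, P i -> gen_submod X (F i)) ->
  gen_submod X (\sum_(i <- r | P i) F i).
Proof.
by apply: big_ind; [exact: gen_submod_zero | exact: span_add].
Qed.

Lemma span_image X (Y : U -> Prop) (f : V -> U) : linear f ->
  (forall v, X v -> gen_submod Y (f v)) ->
  forall v, gen_submod X v -> gen_submod Y (f v).
Proof.
move=> lf fX v; rewrite -[f v]/(linear_of lf v).
elim=> {v} [v /fX//||c u v _ IHu _ IHv]; first by rewrite raddf0; constructor.
by rewrite linearP; apply: gen_submod_lin.
Qed.

Lemma span_sub X Y :
  (forall v, X v -> gen_submod Y v) ->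
  forall v, gen_submod X v -> gen_submod Y v.
Proof.
move=> XY v; elim=> {v} [v /XY//||c u v _ IHu _ IHv]; first by constructor.
exact: gen_submod_lin.
Qed.

Lemma span_unsign X e v : gen_submod X ((-1) ^+ e *: v) -> gen_submod X v.
Proof.
by move=> /(span_scale ((-1) ^+ e)); rewrite scalerA -exprMn mulrNN mul1r
  expr1n scale1r.
Qed.

End LinearSpan.

(** * Commutation up to sign and ordered elementary polynomials *)

Section Algebra.
Variables (k : fieldType) (R : algType k).
Implicit Types a b c f : R.

Lemma mulr_right_linear a : linear (fun f => f * a).
Proof. by move=> c f g; rewrite mulrDl scalerAl. Qed.

Lemma signD (d e : nat) (f : R) :
  (-1) ^+ d *: ((-1) ^+ e *: f) = ((-1) ^+ (d + e) : k) *: f.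
Proof. by rewrite scalerA exprD. Qed.

Definition scomm a b := exists e : nat, a * b = (-1) ^+ e *: (b * a).

Lemma scommN a b : a * b = - (b * a) -> scomm a b.
Proof. by move=> ab; exists 1%N; rewrite ab expr1 scaleN1r. Qed.

Lemma scomm_sym a b : scomm a b -> scomm b a.
Proof.
by case=> e ab; exists e; rewrite ab signD -signr_odd addnn odd_double scale1r.
Qed.

Lemma scomm1 a : scomm a 1.
Proof. by exists 0%N; rewrite mulr1 mul1r scale1r. Qed.

Lemma scommM a b c : scomm a b -> scomm a c -> scomm a (b * c).
Proof.
move=> [d ab] [e ac]; exists (d + e)%N.
by rewrite mulrA ab -scalerAl -(mulrA b a c) ac -scalerAr signD !mulrA.
Qed.

Lemma scommX a b e : scomm a b -> scomm a (b ^+ e).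
Proof.
move=> ab; elim: e => [|e IH]; first by rewrite expr0; apply: scomm1.
by rewrite exprS; apply: scommM.
Qed.

(** The coefficient of t^m in the product of the 1 + y t for y in s, in the
    order of s, with t central. *)
Fixpoint elsym (s : seq R) (m : nat) : R :=
  match s, m with
  | _, 0 => 1
  | [::], _.+1 => 0
  | y :: s', m'.+1 => elsym s' m + y * elsym s' m'
  end.

Lemma elsym0 s : elsym s 0 = 1. Proof. by case: s. Qed.

Lemma elsym_cons y s m : elsym (y :: s) m.+1 = elsym s m.+1 + y * elsym s m.
Proof. by []. Qed.

Lemma elsym_oversize s m : (size s < m)%N -> elsym s m = 0.
Proof.
elim: s m => [|y s IH] [|m] //= sm.
by rewrite !IH // ?mulr0 ?addr0 // ltnW.
Qed.

(** The generating polynomial of s is that of y :: s divided on the left by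
    1 + y t, whose inverse is the geometric series in - y t. *)
Lemma elsym_tail y s m :
  elsym s m = \sum_(j < m.+1) (- y) ^+ j * elsym (y :: s) (m - j).
Proof.
elim: m => [|m IH]; first by rewrite big_ord1 expr0 mul1r !elsym0.
rewrite big_ord_recl expr0 mul1r subn0 elsym_cons.
under eq_bigr => i _ do rewrite lift0 exprS -mulrA subSS.
by rewrite -mulr_sumr -IH mulNr addrK.
Qed.

End Algebra.

(** * Odd divided differences on monomials in two variables *)

Section OddNilCoxeter.
Variables (k : fieldType) (n : nat).
Local Notation S := (SPol k n).
Local Notation D i := (odd_ddiff k (n := n) i).
Local Notation N i := (neg_odd_ddiff k (n := n) i).
Local Notation onc := (gen_subalg (@onc_gen k n)).
Implicit Types (f g w : S) (o : 'I_n.-1) (i j l : nat) (F G : endo S).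
Implicit Types (s t u : seq nat).

(** The value 0 outside the range makes the anticommutation rules hold for all
    pairs of distinct indices. *)
Definition xvar (j : nat) : S := oapp (svar k (n := n)) 0 (insub j).
Local Notation X := xvar.

Lemma xvarE (j : 'I_n) : X j = svar k j.
Proof. by rewrite /X valK. Qed.

Lemma xvar_anticomm j l : j != l -> X j * X l = - (X l * X j).
Proof.
rewrite /X; case: insubP => [j' _ jE|_] /=; last by rewrite mul0r mulr0 oppr0.
case: insubP => [l' _ lE|_] /=; last by rewrite mul0r mulr0 oppr0.
by rewrite -jE -lE val_eqE => jl; apply/eqP; rewrite -addr_eq0 svar_anticomm.
Qed.

Lemma scomm_xvarX j a l b : j != l -> scomm (X j ^+ a) (X l ^+ b).
Proof.
move=> jl; apply: scommX; apply: scomm_sym; apply: scommX; apply: scommN.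
by apply: xvar_anticomm; rewrite eq_sym.
Qed.

Lemma ddiffM o f g : D o (f * g) = D o f * g + skew_aut k o f * D o g.
Proof. by case: (odd_ddiffP k o). Qed.

Lemma ddiff_xlo o f : D o (X o * f) = f - X o.+1 * D o f.
Proof.
rewrite -[val o]/(val (lo o)) -[(val o).+1]/(val (hi o)) !xvarE ddiffM.
case: (odd_ddiffP k o) => -> _.
by rewrite eqxx mul1r skew_aut_var tpermL mulNr.
Qed.

Lemma ddiff_xhi o f : D o (X o.+1 * f) = f - X o * D o f.
Proof.
rewrite -[val o]/(val (lo o)) -[(val o).+1]/(val (hi o)) !xvarE ddiffM.
case: (odd_ddiffP k o) => -> _.
by rewrite eqxx orbT mul1r skew_aut_var tpermR mulNr.
Qed.

Lemma ddiff_xother o j f : j != o -> j != o.+1 ->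
  D o (X j * f) = - (X j * D o f).
Proof.
move=> jlo jhi; rewrite /X; case: insubP => [j' _ jE|_] /=; last first.
  by rewrite !mul0r raddf0 oppr0.
rewrite ddiffM; case: (odd_ddiffP k o) => -> _.
have jlo' : j' != lo o by rewrite -val_eqE jE.
have jhi' : j' != hi o by rewrite -val_eqE jE.
rewrite (negPf jlo') (negPf jhi') mul0r add0r skew_aut_var.
by rewrite tpermD 1?eq_sym // mulNr.
Qed.

Lemma ddiff1 o : D o 1 = 0.
Proof.
apply: (addrI (D o 1)); rewrite addr0 -{3}[1]mulr1 ddiffM.
by rewrite rmorph1 mulr1 mul1r.
Qed.

Lemma ddiff_xother1 o j : j != o -> j != o.+1 -> D o (X j) = 0.
Proof.
by move=> ? ?; rewrite -[X j]mulr1 ddiff_xother // ddiff1 mulr0 oppr0.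
Qed.

Lemma neg_ddiffE o f : N o f = X o * D o (X o.+1 * f).
Proof. by rewrite neg_odd_ddiffE -!xvarE. Qed.

Definition osym (c : S) := forall o, D o c = 0.

Definition rlin (c : S) F := forall f, F (f * c) = F f * c.

Lemma rlin_ddiff o c : D o c = 0 -> rlin c (D o).
Proof. by move=> c0 f; rewrite ddiffM c0 mulr0 addr0. Qed.

Lemma rlin_neg_ddiff o c : D o c = 0 -> rlin c (N o).
Proof. by move=> c0 f; rewrite !neg_ddiffE mulrA rlin_ddiff // mulrA. Qed.

Lemma rlinM F G c : rlin c F -> rlin c G -> rlin c (F * G).
Proof. by move=> cF cG f; rewrite !endo_mulE cG cF. Qed.

Lemma rlin1 c : rlin c 1.
Proof. by []. Qed.

Lemma rlinZ a F c : rlin c F -> rlin c (a *: F).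
Proof. by move=> cF f; rewrite !endo_scaleE cF scalerAl. Qed.

Lemma rlinD F G c : rlin c F -> rlin c G -> rlin c (F + G).
Proof. by move=> cF cG f; rewrite !endo_addE cF cG mulrDl. Qed.

Lemma rlin_exp F c a : rlin c F -> rlin (c ^+ a) F.
Proof.
move=> cF; elim: a => [|a IH] f; first by rewrite !mulr1.
by rewrite exprSr mulrA cF IH mulrA.
Qed.

Lemma onc_ddiff o : onc (D o).
Proof. by apply: gen_subalg_gen; exists o; left. Qed.

Lemma onc_neg_ddiff o : onc (N o).
Proof. by apply: gen_subalg_gen; exists o; right. Qed.

(** Odd symmetric polynomials are constants for the odd nilCoxeter algebra, by
    the twisted Leibniz rule. *)
Lemma onc_rlin F c : onc F -> osym c -> rlin c F.
Proof.
move=> oF c0.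
elim: oF => {F} [_ [o [->|->]]||a F G _ IHF _ IHG|F G _ IHF _ IHG].
- exact: rlin_ddiff.
- exact: rlin_neg_ddiff.
- exact: rlin1.
- by apply: rlinD => //; apply: rlinZ.
- exact: rlinM.
Qed.

Lemma osymM c d : osym c -> osym d -> osym (c * d).
Proof. by move=> c0 d0 o; rewrite rlin_ddiff // c0 mul0r. Qed.

Lemma osym_lin a c d : osym c -> osym d -> osym (a *: c + d).
Proof. by move=> c0 d0 o; rewrite linearP c0 d0 scaler0 addr0. Qed.

(** The exponents (q, p) of x_(j+1) and x_j range over P, so that degree bounds
    can be tracked by arithmetic on P alone. *)
Definition mon2 (P : nat -> nat -> Prop) j (f : S) :=
  exists q p, P q p /\ f = X j.+1 ^+ q * X j ^+ p.
Local Notation span2 P j := (gen_submod (mon2 P j)).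

Lemma mon2_xlo P Q j f : (forall q p, P q p -> Q q p.+1) ->
  span2 P j f -> span2 Q j (X j * f).
Proof.
move=> PQ; apply: (span_image (lmul_linear _)) => _ [q [p [Pqp ->]]].
have [e eE] : scomm (X j) (X j.+1 ^+ q).
  by rewrite -[X j]expr1; apply: scomm_xvarX; rewrite neq_ltn ltnSn.
rewrite mulrA eE -scalerAl -mulrA -exprS; apply/span_scale/gen_submod_gen.
by exists q, p.+1; split => //; apply: PQ.
Qed.

Lemma mon2_xhi P Q j f : (forall q p, P q p -> Q q.+1 p) ->
  span2 P j f -> span2 Q j (X j.+1 * f).
Proof.
move=> PQ; apply: (span_image (lmul_linear _)) => _ [q [p [Pqp ->]]].
rewrite mulrA -exprS; apply: gen_submod_gen.
by exists q.+1, p; split => //; apply: PQ.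
Qed.

Lemma mon2_sub P Q j f : (forall q p, P q p -> Q q p) ->
  span2 P j f -> span2 Q j f.
Proof.
move=> PQ; apply: span_sub => _ [q [p [Pqp ->]]].
by apply: gen_submod_gen; exists q, p; split => //; apply: PQ.
Qed.

Lemma ddiff_xlohi o f : D o (X o * (X o.+1 * f)) = X o.+1 * (X o * D o f).
Proof. by rewrite ddiff_xlo ddiff_xhi mulrBr opprB addrC subrK. Qed.

Lemma ddiff_xhilo o f : D o (X o.+1 * (X o * f)) = X o * (X o.+1 * D o f).
Proof. by rewrite ddiff_xhi ddiff_xlo mulrBr opprB addrC subrK. Qed.

(** The exponents of the differentiated monomial stay below the larger of the
    two, since x_o x_(o+1) can be taken out of the operator up to a sign. *)
Lemma ddiff_mon2 o b a :
  span2 (fun q p => q < maxn b a /\ p < maxn b a)%N o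
    (D o (X o.+1 ^+ b * X o ^+ a)).
Proof.
have ii : val o != o.+1 by rewrite neq_ltn ltnSn.
elim: b a => [|b IHb] a.
  rewrite expr0 mul1r; elim: a => [|a IHa].
    by rewrite expr0 ddiff1; apply: gen_submod_zero.
  rewrite exprS ddiff_xlo; apply: span_add.
    by apply: gen_submod_gen; exists 0%N, a; split; [lia | rewrite mul1r].
  by apply: span_opp; apply: mon2_xhi IHa => q p; lia.
case: a => [|a].
  rewrite expr0 mulr1 exprS ddiff_xhi; apply: span_add.
    by apply: gen_submod_gen; exists b, 0%N; split; [lia | rewrite mulr1].
  apply: span_opp; move: (IHb 0%N); rewrite expr0 mulr1.
  by apply: mon2_xlo => q p; lia.
have [e eE] : scomm (X o.+1 ^+ b) (X o).
  by rewrite -[X o]expr1; apply: scomm_xvarX; rewrite eq_sym.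
rewrite exprS exprS -mulrA (mulrA _ (X o)) eE -scalerAl -scalerAr linearZ /=.
apply: span_scale; rewrite -mulrA ddiff_xhilo.
apply: (@mon2_xlo (fun q p => q < (maxn b a).+1 /\ p < maxn b a)%N) => [q p|].
  by lia.
by apply: mon2_xhi (IHb a) => q p; lia.
Qed.

Lemma neg_ddiff_mon2 o b a B : (b <= B)%N -> (a <= B.+1)%N ->
  span2 (fun q p => q <= B /\ p <= B.+1)%N o (N o (X o.+1 ^+ b * X o ^+ a)).
Proof.
move=> bB aB; rewrite neg_ddiffE mulrA -exprS.
by apply: mon2_xlo (ddiff_mon2 o b.+1 a) => q p; lia.
Qed.

(** D_o acts on powers of x_o as a shift, modulo terms with a positive power
    of x_(o+1). *)
Lemma ddiff_xlo_lead o a :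
  exists2 g, D o (X o ^+ a.+1) = X o ^+ a + g &
    span2 (fun q p => 0 < q <= a)%N o g.
Proof.
rewrite exprS ddiff_xlo.
exists (- (X o.+1 * D o (X o ^+ a))) => //; apply: span_opp.
rewrite -[X o ^+ a]mul1r; apply: mon2_xhi (ddiff_mon2 o 0 a) => q p; lia.
Qed.

(** Modulo terms with a positive power of x_(o+1), N_o turns x_(o+1)^b into
    x_o^(b+1) up to sign; if x_o occurs too, then x_(o+1) x_o leaves D_o, up to
    sign and order, and every term keeps a factor x_(o+1). *)
Lemma neg_ddiff_lead o b e : (e <= b.+1)%N ->
  span2 (fun q p => 0 < q <= b)%N o
    (N o (X o.+1 ^+ b * X o ^+ e) -
     (e == 0%N)%:R *: ((-1) ^+ b *: X o ^+ b.+1)).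
Proof.
move=> eb; rewrite neg_ddiffE; case: e eb => [|e] eb /=.
  rewrite scale1r mulr1 -exprS => {eb}.
  elim: b => [|b IH].
    rewrite scale1r !expr1 -[X o.+1]mulr1 ddiff_xhi ddiff1.
    rewrite mulr0 subr0 mulr1 subrr.
    exact: gen_submod_zero.
  rewrite (exprS _ b.+1) ddiff_xhi mulrBr.
  rewrite [(-1) ^+ b.+1]exprS mulN1r scaleNr opprK.
  rewrite -addrA; apply: span_add.
    apply: (@mon2_xlo (fun q p => 0 < q <= b.+1)%N) => //.
    by apply: gen_submod_gen; exists b.+1, 0%N; rewrite mulr1; split => //; lia.
  rewrite addrC (exprS _ b.+1) scalerAr -mulrBr -opprB mulrN.
  by apply: span_opp; apply: mon2_xlo IH; lia.
rewrite scale0r subr0.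
have ii : val o != o.+1 by rewrite neq_ltn ltnSn.
have [d dE] : scomm (X o.+1 ^+ b) (X o).
  by rewrite -[X o]expr1; apply: scomm_xvarX; rewrite eq_sym.
rewrite exprS (mulrA _ (X o)) dE -!scalerAl -!scalerAr linearZ /= -scalerAr.
apply: span_scale; rewrite -mulrA ddiff_xhilo.
apply: (@mon2_xlo (fun q p => 0 < q <= b)%N) => [//|].
apply: (@mon2_xlo (fun q p => 0 < q <= b)%N) => [//|].
by apply: mon2_xhi (ddiff_mon2 o b e) => q p; lia.
Qed.

(** * Staircase monomials *)

(** Exponents of consecutive variables, ending with x_(n-1): if s starts at the
    exponent of x_i, then size s = n - i, and the bound for its head is
    n - i - 1, so x_(n-1) has exponent 0. *)
Fixpoint stair s := if s is a :: s' then (a <= size s')%N && stair s' else true.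

(** Decreasing order of the variables: D_j and N_j with i < j then act on
    rmon i (a :: s) through its left factor, without a sign. *)
Fixpoint rmon i s : S := if s is a :: s' then rmon i.+1 s' * X i ^+ a else 1.

Definition stair_mon i d f := exists s, [/\ stair s, size s = d & f = rmon i s].
Local Notation Vspan i d := (gen_submod (stair_mon i d)).

Lemma scomm_rmon l i s a : (l < i)%N -> scomm (X l ^+ a) (rmon i s).
Proof.
elim: s i => [|b s IH] i li /=; first exact: scomm1.
by apply: scommM; [apply: IH; lia | apply: scomm_xvarX; lia].
Qed.

Definition lanti l F := forall f, F (X l * f) = - (X l * F f).

Lemma lanti_ddiff o l : (o.+1 < l)%N -> lanti l (D o).
Proof. by move=> ol f; apply: ddiff_xother; lia. Qed.

Lemma lanti_neg_ddiff o l : (o.+1 < l)%N -> lanti l (N o).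
Proof.
have swap j g : j != l -> X j * (X l * g) = - (X l * (X j * g)).
  by move=> jl; rewrite mulrA xvar_anticomm // mulNr mulrA.
move=> ol f; rewrite !neg_ddiffE swap; last by lia.
by rewrite linearN /= (lanti_ddiff ol) opprK swap //; lia.
Qed.

Lemma lanti_rmon j s F : (forall l, (j <= l)%N -> lanti l F) ->
  exists e : nat, forall f, F (rmon j s * f) = (-1) ^+ e *: (rmon j s * F f).
Proof.
elim: s j => [|a s IH] j aF /=.
  by exists 0%N => f; rewrite scale1r !mul1r.
have [|e eE] := IH j.+1; first by move=> l jl; apply: aF; lia.
exists (e + a)%N => f; rewrite -mulrA eE -signD -mulrA; congr (_ *: _).
rewrite scalerAr; congr (_ * _).
elim: a f => [|a IHa] f; first by rewrite scale1r !mul1r.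
by rewrite exprS -mulrA aF // IHa exprS mulN1r scaleNr -mulrA -scalerAr.
Qed.

(** An operator that is transparent, up to sign, to all variables but x_o and
    x_(o+1) preserves the staircase if it does so in these two variables. The
    tail after x_(o+1) has size B, which bounds the exponent of x_(o+1). *)
Lemma stair_stable_split o F :
    (forall l, (l < o)%N -> rlin (X l) F) ->
    (forall l, (o.+1 < l)%N -> lanti l F) ->
    (forall b a B, (b <= B)%N -> (a <= B.+1)%N ->
       span2 (fun q p => q <= B /\ p <= B.+1)%N o
         (F (X o.+1 ^+ b * X o ^+ a))) ->
  forall s i, (i <= o)%N -> (o.+1 < i + size s)%N -> stair s ->
    Vspan i (size s) (F (rmon i s)).
Proof.
move=> rF lF mF; elim=> [|a s IH] i io os; first by move: os; rewrite /=; lia.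
move=> /andP [as_ ss] /=; case: (ltngtP i o) io => // [io|ioE] _.
  rewrite (rlin_exp a (rF i io)).
  have := IH i.+1 io; rewrite addSnnS => /(_ os ss).
  apply: (span_image (mulr_right_linear _)) => _ [t [st tE ->]].
  by apply: gen_submod_gen; exists (a :: t); rewrite /= tE as_ st.
case: s as_ ss os {IH} => [|b s] /=; first by lia.
move=> a_s /andP [bs ss] _; rewrite -mulrA ioE.
have [e ->] := @lanti_rmon o.+2 s F lF; apply: span_scale.
apply: (span_image (lmul_linear _)) (mF b a (size s) bs a_s).
move=> _ [q [p [[qs ps] ->]]].
rewrite mulrA; apply: gen_submod_gen; exists [:: p, q & s].
by split=> //; apply/and3P.
Qed.

Lemma onc_stable F f : onc F -> Vspan 0 n f -> Vspan 0 n (F f).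
Proof.
move=> oF; have stab G :
    (forall s, stair s -> size s = n -> Vspan 0 (size s) (G (rmon 0 s))) ->
    forall g, Vspan 0 n g -> Vspan 0 n (G g).
  move=> GV; apply: span_image; first exact: linearP.
  by move=> _ [s [ss sn ->]]; have := GV s ss sn; rewrite {1}sn.
elim: oF f => {F} [F [o oE]||a F G _ IHF _ IHG|F G _ IHF _ IHG] f //.
- apply: stab => s ss sn.
  have on : (o.+1 < size s)%N by have := ltn_ord o; rewrite sn; lia.
  case: oE => ->; apply: (@stair_stable_split o) => //.
  + by move=> l lo; apply/rlin_ddiff/ddiff_xother1; lia.
  + by move=> l; apply: lanti_ddiff.
  + by move=> b a B bB aB; apply: mon2_sub (ddiff_mon2 o b a) => q p; lia.
  + by move=> l lo; apply/rlin_neg_ddiff/ddiff_xother1; lia.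
  + by move=> l; apply: lanti_neg_ddiff.
  + by move=> b a B; apply: neg_ddiff_mon2.
- move=> Vf; rewrite endo_addE.
  by apply: gen_submod_lin; [apply: IHF | apply: IHG].
- by move=> Vf; rewrite endo_mulE; apply/IHF/IHG.
Qed.

Lemma stair_nthP s :
  (forall j, (j < size s)%N -> (nth 0 s j + j < size s)%N) <-> stair s.
Proof.
elim: s => [|a s IH] //=; split=> [H|/andP [as_ /IH H]].
  apply/andP; split; first by have := H 0%N isT => /=; lia.
  by apply/IH => j js; have := H j.+1 js => /=; lia.
by case=> [|j] /= js; [lia | have := H j js; lia].
Qed.

Lemma rmon_prod i s :
  exists e : nat,
    rmon i s = (-1) ^+ e *: \prod_(j < size s) X (i + j) ^+ nth 0%N s j.
Proof.
elim: s i => [|a s IH] i /=; first by exists 0%N; rewrite big_ord0 scale1r.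
have [e eE] := IH i.+1.
have [d dE] := scomm_sym (@scomm_rmon i i.+1 s a (ltnSn i)).
exists (d + e)%N; rewrite dE eE big_ord_recl addn0 -signD -scalerAr.
congr (_ *: (_ *: (_ * _))); apply: eq_bigr => j _ /=.
by rewrite /bump /= addSnnS.
Qed.

Lemma rmon_smonom s (a : {ffun 'I_n.-1 -> nat}) : size s = n -> stair s ->
    (forall j : 'I_n.-1, a j = nth 0%N s j) ->
  exists e : nat, rmon 0 s = (-1) ^+ e *: smonom k a.
Proof.
move=> sn ss aE; have [e ->] := rmon_prod 0 s; exists e; congr (_ *: _).
(* The list has one exponent more than the monomial: that of x_(n-1). *)
have last0 j : (j < size s)%N -> ~~ (j < n.-1)%N -> nth 0%N s j = 0%N.
  by move=> js jn; have := proj2 (stair_nthP s) ss j js; lia.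
rewrite /smonom -(big_mkord xpredT (fun j => X (0 + j) ^+ nth 0%N s j)) sn.
have -> : \prod_(0 <= j < n) X (0 + j) ^+ nth 0%N s j
        = \prod_(0 <= j < n.-1) X (0 + j) ^+ nth 0%N s j.
  rewrite (@big_cat_nat _ _ _ n.-1) ?leq_pred //= [X in _ * X]big_nat_cond.
  rewrite [X in _ * X]big1 ?mulr1 // => j; rewrite andbT => /andP [nj jn].
  by rewrite last0 -?leqNgt // sn.
by rewrite big_mkord; apply: eq_bigr => j _; rewrite aE -xvarE.
Qed.

Lemma stair_predE f : f \in stair_pred (k := k) (n := n) <-> Vspan 0 n f.
Proof.
split=> [/asboolP|Vf]; last apply/asboolP; last first.
  apply: span_sub Vf => _ [s [ss sn ->]].
  pose a : {ffun 'I_n.-1 -> nat} := [ffun j : 'I_n.-1 => nth 0%N s j].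
  have [|e ->] := @rmon_smonom s a sn ss; first by move=> j; rewrite ffunE.
  apply/span_scale/gen_submod_gen; exists a => //; apply/forallP => j.
  have := proj2 (stair_nthP s) ss j; have := ltn_ord j; rewrite ffunE; lia.
apply: span_sub => _ [a /forallP sa ->].
pose s := mkseq (fun j => oapp a 0%N (insub j)) n.
have sn : size s = n by rewrite size_mkseq.
have ss : stair s.
  apply/stair_nthP => j; rewrite sn => jn; rewrite nth_mkseq //.
  case: insubP => [j' _ jE|_] /=; last by lia.
  by have := sa j'; rewrite -jE /=; have := ltn_ord j'; lia.
have [|e eE] := @rmon_smonom s a sn ss.
  move=> j; rewrite nth_mkseq ?valK //.
  by have := ltn_ord j; lia.
by apply: (@span_unsign _ _ _ e); rewrite -eE; apply: gen_submod_gen; exists s.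
Qed.

(** * Matrix units *)

(** Right linearity over the earlier variables is what lets a matrix unit in
    the later variables act on monomials in all of them. *)
Definition onc_above i F := onc F /\ forall l, (l < i)%N -> rlin (X l) F.

Lemma onc_above1 i : onc_above i 1.
Proof. by split=> [|l _]; [apply: gen_subalg_one | apply: rlin1]. Qed.

Lemma onc_aboveM i F G : onc_above i F -> onc_above i G -> onc_above i (F * G).
Proof.
move=> [oF rF] [oG rG]; split=> [|l li]; first exact: gen_subalg_mul.
by apply: rlinM; [apply: rF | apply: rG].
Qed.

Lemma onc_aboveZ i a F : onc_above i F -> onc_above i (a *: F).
Proof.
move=> [oF rF]; split=> [|l li]; last by apply/rlinZ/rF.
have -> : a *: F = (a - 1) *: F + F by rewrite scalerBl scale1r subrK.
exact: gen_subalg_lin.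
Qed.

Lemma onc_aboveX i F a : onc_above i F -> onc_above i (F ^+ a).
Proof.
move=> aF; elim: a => [|a IH]; first exact: onc_above1.
by rewrite exprS; apply: onc_aboveM.
Qed.

Lemma onc_above_ddiff o : onc_above o (D o).
Proof.
split=> [|l lo]; first exact: onc_ddiff.
by apply/rlin_ddiff/ddiff_xother1; lia.
Qed.

Lemma onc_above_neg_ddiff o : onc_above o (N o).
Proof.
split=> [|l lo]; first exact: onc_neg_ddiff.
by apply/rlin_neg_ddiff/ddiff_xother1; lia.
Qed.

Lemma onc_aboveW i F : onc_above i.+1 F -> onc_above i F.
Proof. by move=> [oF rF]; split=> // l li; apply: rF; lia. Qed.

Definition matrix_unit i s t F := forall u, stair u -> size u = size t ->
  F (rmon i u) = if u == t then rmon i s else 0.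

Lemma stair_nseq0 d : stair (nseq d 0%N).
Proof. by elim: d. Qed.

Lemma rmon_nseq0 i d : rmon i (nseq d 0%N) = 1.
Proof. by elim: d i => //= d IH i; rewrite IH mulr1. Qed.

Section Step.
Variables (o : 'I_n.-1) (d : nat).
Local Notation zeros := (nseq d.+1 0%N).
Hypothesis tail_units : forall s t, stair s -> stair t ->
  size s = d.+1 -> size t = d.+1 ->
  exists2 F, onc_above o.+1 F & matrix_unit o.+1 s t F.

Lemma unit_xlo s t F a : onc_above o.+1 F -> matrix_unit o.+1 s t F ->
  forall u, stair u -> size u = size t ->
  F (rmon o (a :: u)) = if u == t then rmon o (a :: s) else 0.
Proof.
move=> [_ rF] uF u su ut /=; rewrite (rlin_exp a (rF o _)) // uF //.
by case: eqP => _ //; rewrite mul0r.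
Qed.

(** The error terms of ddiff_xlo_lead and neg_ddiff_lead have a positive power
    of x_(o+1), within the staircase bound, so their tail is a basis monomial
    other than 1. *)
Lemma unit_kills_xhi s F f : onc_above o.+1 F -> matrix_unit o.+1 s zeros F ->
  span2 (fun q p => 0 < q <= d)%N o f -> F f = 0.
Proof.
move=> [_ rF] uF; elim=> {f} [_ [q [p [/andP [q0 qd] ->]]]||c f g _ Ff _ Fg].
- have := uF (q :: nseq d 0%N).
  rewrite /= size_nseq qd stair_nseq0 rmon_nseq0 mul1r => /(_ isT erefl).
  case: eqP => [[qE]|_ Fq]; first by rewrite qE in q0.
  by rewrite (rlin_exp p (rF o _)) // Fq mul0r.
- exact: raddf0.
- by rewrite linearP Ff Fg scaler0 addr0.
Qed.

Lemma unit_xlo_zeros s F a : onc_above o.+1 F -> matrix_unit o.+1 s zeros F ->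
  F (X o ^+ a) = rmon o (a :: s).
Proof.
move=> aF uF; have := unit_xlo a aF uF (stair_nseq0 d.+1) erefl.
by rewrite eqxx [rmon o (a :: zeros)]/= rmon_nseq0 mulr1 mul1r.
Qed.

(** L = P D_o with P the projection to the monomial 1 of the tail. *)
Lemma shift_exists : exists2 L, onc_above o L & forall b a, (a <= d.+1)%N ->
  (L ^+ b) (X o ^+ a) = if (b <= a)%N then X o ^+ (a - b) else 0.
Proof.
have sz : size zeros = d.+1 by rewrite size_nseq.
have [P aP uP] := tail_units (stair_nseq0 d.+1) (stair_nseq0 d.+1) sz sz.
have L0 : (P * D o) 1 = 0 by rewrite endo_mulE ddiff1 raddf0.
have LS a : (a <= d)%N -> (P * D o) (X o ^+ a.+1) = X o ^+ a.
  move=> ad; rewrite endo_mulE; have [g -> g0] := ddiff_xlo_lead o a.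
  rewrite raddfD /= (unit_xlo_zeros _ aP uP) /= rmon_nseq0 !mul1r.
  rewrite (unit_kills_xhi aP uP) ?mulr1 ?addr0 //.
  by apply: mon2_sub g0 => q p; lia.
exists (P * D o).
  by apply: onc_aboveM (onc_above_ddiff o); apply: onc_aboveW.
elim=> [|b IH] a ad; first by rewrite subn0.
rewrite exprSr endo_mulE; case: a ad => [|a] ad; first by rewrite L0 raddf0.
by rewrite LS // IH // ltnW.
Qed.

(** R = P N_o T up to sign, where T maps the monomial 1 of the tail to
    x_(o+1)^d, the largest power that the staircase allows. *)
Lemma raise_exists : exists2 R, onc_above o R & forall a, (a <= d.+1)%N ->
  R (X o ^+ a) = if a == 0%N then X o ^+ d.+1 else 0.
Proof.
have sz : size zeros = d.+1 by rewrite size_nseq.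
have [P aP uP] := tail_units (stair_nseq0 d.+1) (stair_nseq0 d.+1) sz sz.
have stop : stair (d :: nseq d 0%N) by rewrite /= size_nseq leqnn stair_nseq0.
have [|T aT uT] := tail_units stop (stair_nseq0 d.+1) _ sz.
  by rewrite /= size_nseq.
exists ((-1) ^+ d *: (P * N o * T)) => [|a ad].
  apply: onc_aboveZ; apply: onc_aboveM; last exact: onc_aboveW.
  by apply: onc_aboveM (onc_above_neg_ddiff o); apply: onc_aboveW.
rewrite endo_scaleE !endo_mulE (unit_xlo_zeros _ aT uT) /= rmon_nseq0 !mul1r.
have /(unit_kills_xhi aP uP)/eqP := neg_ddiff_lead o ad.
rewrite raddfB /= subr_eq0 => /eqP ->; rewrite !linearZ /=.
rewrite (unit_xlo_zeros _ aP uP) /= rmon_nseq0 !mul1r.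
case: eqP => _ /=; last by rewrite scale0r.
by rewrite scale1r scalerA -exprMn mulrNN mul1r expr1n scale1r.
Qed.

(** Project to the tail t, lower x_o^b to 1, which R then singles out and sends
    to x_o^(d+1), lower this to x_o^a, and create the tail s. *)
Lemma matrix_unit_step s t : stair s -> stair t ->
    size s = d.+2 -> size t = d.+2 ->
  exists2 F, onc_above o F & matrix_unit o s t F.
Proof.
case: s t => [|a s] [|b t] // /andP [a_s ss] /andP [bt st] [sd] [td].
have sz : size zeros = d.+1 by rewrite size_nseq.
have [E aE uE] := tail_units ss (stair_nseq0 d.+1) sd sz.
have [E' aE' uE'] := tail_units (stair_nseq0 d.+1) st sz td.
have [L aL LE] := shift_exists; have [R aR RE] := raise_exists.
exists (E * L ^+ (d.+1 - a) * R * L ^+ b * E').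
  do 4?[apply: onc_aboveM]; by [exact: onc_aboveX | exact: onc_aboveW|].
move=> [|c u] // /andP [cu su] [uE2]; rewrite !endo_mulE.
rewrite (unit_xlo _ aE' uE') // eqseq_cons.
case: (u =P t) => [_|_]; last by rewrite andbF !raddf0.
rewrite andbT [rmon o (c :: zeros)]/= rmon_nseq0 mulr1 mul1r LE; last by lia.
case: (leqP b c) => [bc|cb]; last by rewrite !raddf0 ifF //; lia.
rewrite RE; last by lia.
rewrite subn_eq0.
case: (leqP c b) => [cb|bc']; last by rewrite !raddf0 ifF //; lia.
rewrite LE // leq_subr subKn; last by lia.
by rewrite (unit_xlo_zeros _ aE uE) ifT //; lia.
Qed.

End Step.

Lemma matrix_units d i s t : (i + d.+1)%N = n -> stair s -> stair t ->
    size s = d.+1 -> size t = d.+1 ->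
  exists2 F, onc_above i F & matrix_unit i s t F.
Proof.
elim: d i s t => [|d IH] i s t idn.
  (* i = n - 1: the staircase allows only the exponent 0 of x_(n-1) *)
  case: s t => [|a [|? ?]] [|b [|? ?]] //=; rewrite !andbT !leqn0.
  move=> /eqP-> /eqP-> _ _; exists 1; first exact: onc_above1.
  case=> [|c [|? ?]] //=; rewrite andbT leqn0 => /eqP-> _.
  by rewrite eqxx.
have io : (i < n.-1)%N by lia.
apply: (@matrix_unit_step (Ordinal io)) => s' t'; apply: IH.
by rewrite /= addSnnS.
Qed.

(** * Generation over the odd symmetric polynomials *)

Definition altvar j : S := (-1) ^+ j *: X j.
Local Notation Y := altvar.

Definition tail_elsym i m := elsym [seq Y j | j <- iota i (n - i)] m.

Lemma ddiff_elsym_above o i d m : (o.+1 < i)%N ->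
  D o (elsym [seq Y j | j <- iota i d] m) = 0.
Proof.
elim: d i m => [|d IH] i [|m] oi; rewrite /= ?ddiff1 ?raddf0 //.
rewrite linearD /= IH /Y -?scalerAl ?linearZ /=; last by lia.
by rewrite ddiff_xother ?IH ?mulr0 ?oppr0 ?scaler0 ?addr0 //; lia.
Qed.

(** The factors 1 + y_o t and 1 + y_(o+1) t contribute y_o + y_(o+1) and
    y_o y_(o+1). D_o kills y_o + y_(o+1) because the signs alternate, and it
    kills x_o x_(o+1). *)
Lemma ddiff_elsym o i d m : (i <= o)%N -> (o.+1 < i + d)%N ->
  D o (elsym [seq Y j | j <- iota i d] m) = 0.
Proof.
elim: d i m => [|d IH] i m io oid; first by lia.
case: m => [|m]; first by rewrite elsym0 ddiff1.
case: (ltngtP i o) io => // [io|ioE] _.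
  rewrite /= linearD /= IH; [|lia..].
  rewrite /Y -scalerAl linearZ /= ddiff_xother; [|lia..].
  by rewrite IH ?mulr0 ?oppr0 ?scaler0 ?addr0 //; lia.
subst i; case: d oid {IH} => [|d] od; first by lia.
set s := [seq Y j | j <- iota o.+2 d].
have s0 m' : D o (elsym s m') = 0 by apply: ddiff_elsym_above.
have DY m' : D o (Y o.+1 * elsym s m') + D o (Y o * elsym s m') = 0.
  rewrite /Y -!scalerAl !linearZ /= ddiff_xhi ddiff_xlo s0 !mulr0 !subr0.
  by rewrite exprS mulN1r scaleNr addNr.
have DYY m' : D o (Y o * (Y o.+1 * elsym s m')) = 0.
  rewrite /Y -!scalerAl -!scalerAr !linearZ /= ddiff_xlohi s0 !mulr0.
  by rewrite !scaler0.
rewrite [map _ _]/= -/s !elsym_cons !linearD /= s0 add0r.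
case: m => [|m]; first by rewrite elsym0 -(elsym0 s) DY.
by rewrite mulrDr linearD /= DYY addr0 DY.
Qed.

Lemma tail_elsym0_osym m : osym (tail_elsym 0 m).
Proof. by move=> o; apply: ddiff_elsym => //; have := ltn_ord o; lia. Qed.

Lemma tail_elsymS i m : (i < n)%N ->
  tail_elsym i m.+1 = tail_elsym i.+1 m.+1 + Y i * tail_elsym i.+1 m.
Proof.
by move=> i_n; rewrite /tail_elsym -[(n - i)%N]prednK ?subn_gt0 // -subnS.
Qed.

(** The right side of elsym_tail at degree n - i for the n - i - 1 variables
    after x_i. Its last summand is (- y_i)^(n - i), which the relation expresses
    by lower powers of x_i. *)
Lemma tail_elsym_top i : (i < n)%N ->
  \sum_(j < (n - i).+1) (- Y i) ^+ j * tail_elsym i (n - i - j) = 0.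
Proof.
move=> i_n; set s := [seq Y j | j <- iota i.+1 (n - i.+1)].
rewrite -[RHS](@elsym_oversize _ S s (n - i)).
  rewrite (elsym_tail (Y i)) /tail_elsym.
  by rewrite -[(n - i)%N]prednK ?subn_gt0 // -subnS.
by rewrite size_map size_iota; lia.
Qed.

(** Combinations of staircase monomials in x_0, ..., x_(i-1) with odd symmetric
    coefficients on the right; the bound for the exponent of x_i' is
    n - i' - 1. *)
Fixpoint init_span i : S -> Prop :=
  if i is i'.+1 then
    gen_submod (fun f => exists a w,
      [/\ (a + i <= n)%N, init_span i' w & f = X i' ^+ a * w])
  else osym.
Local Notation W := init_span.

Lemma init_span_lin i c f g : W i f -> W i g -> W i (c *: f + g).
Proof. by case: i => [|i]; [apply: osym_lin | apply: gen_submod_lin]. Qed.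

Lemma init_span0 i : W i 0.
Proof.
by case: i => [|i]; [move=> o; apply: raddf0 | apply: gen_submod_zero].
Qed.

Lemma init_spanZ i c f : W i f -> W i (c *: f).
Proof.
by move=> Wf; rewrite -[_ *: _]addr0; apply/init_span_lin/init_span0.
Qed.

Lemma init_span_osym i f c : W i f -> osym c -> W i (f * c).
Proof.
move=> Wf c0; elim: i f Wf => [|i IH] f /=; first by move=> Wf; apply: osymM.
apply: (span_image (mulr_right_linear c)) => _ [a [w [ai Ww ->]]].
apply: gen_submod_gen; exists a, (w * c).
by rewrite mulrA; split=> //; apply: IH.
Qed.

Lemma init_spanS i f : (i < n)%N -> W i f -> W i.+1 f.
Proof.
by move=> i_n Wf; apply: gen_submod_gen; exists 0%N, f; rewrite mul1r; split.
Qed.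

Lemma init_span1 i : (i <= n)%N -> W i 1.
Proof.
elim: i => [|i IH] i_n; first by move=> o; apply: ddiff1.
by apply: init_spanS => //; apply: IH; lia.
Qed.

(** An element of init_span i' is a sum of products p c with p a monomial in
    the first i' variables and c odd symmetric, and g p c equals p g c up to sign. *)
Lemma init_span_mul i i' g f : W i g ->
    (forall j h, (j < i')%N -> W i h -> W i (X j * h)) ->
    (forall j, (j < i')%N -> scomm g (X j)) ->
  W i' f -> W i (g * f).
Proof.
move=> Wg; elim: i' f => [|i' IH] f Wx gx; first exact: init_span_osym.
have lX a h : W i h -> W i (X i' ^+ a * h).
  by elim: a h => [|a IHa] h Wh; rewrite ?mul1r // exprS -mulrA; apply/Wx/IHa.
move=> /=; elim=> {f} [_ [a [w [_ Ww ->]]]||c f h _ Wf _ Wh].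
- have [e eE] := scommX a (gx i' (ltnSn _)).
  rewrite mulrA eE -scalerAl -mulrA; apply/init_spanZ/lX/IH => // j.
    by move=> h ji; apply: Wx; lia.
  by move=> ji; apply: gx; lia.
- by rewrite mulr0; apply: init_span0.
- by rewrite mulrDr -scalerAr; apply: init_span_lin.
Qed.

(** The two claims need each other: reducing x_i^(n - i) uses that the tail
    elementary polynomials lie in the span for i, and these pass to the next i
    by multiplication with x_i. *)
Lemma init_span_closed i : (i <= n)%N ->
  (forall j f, (j < i)%N -> W i f -> W i (X j * f)) /\
  forall m, W i (tail_elsym i m).
Proof.
elim: i => [|i IH] i_n; first by split=> // m; apply: tail_elsym0_osym.
have [|Wx We] := IH; first by lia.
have Wpow a w : (a < n - i)%N -> W i w -> W i.+1 (X i ^+ a * w).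
  by move=> ai Ww; apply: gen_submod_gen; exists a, w; split => //; lia.
have WxS j f : (j < i)%N -> W i.+1 f -> W i.+1 (X j * f).
  move=> ji; apply: (span_image (lmul_linear _)) => _ [a [w [ai Ww ->]]].
  have [e eE] : scomm (X j) (X i ^+ a).
    by rewrite -[X j]expr1; apply: scomm_xvarX; lia.
  rewrite mulrA eE -scalerAl -mulrA; apply: (@init_spanZ i.+1).
  by apply: Wpow; [lia | apply: Wx].
have Wtop : W i.+1 (X i ^+ (n - i)).
  have := tail_elsym_top i_n.
  rewrite big_ord_recr /= subnn /tail_elsym elsym0 mulr1.
  move/eqP; rewrite addrC addr_eq0 => /eqP.
  rewrite /Y -scaleNr exprZn => E.
  have /(congr1 (fun f => (((- (-1) ^+ i) ^+ (n - i) : k)^-1) *: f)) := E.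
  rewrite scalerK; last by rewrite expf_neq0 // oppr_eq0 signr_eq0.
  move=> ->; apply/span_scale/span_opp.
  apply: span_sum => j _; rewrite exprZn -scalerAl; apply: span_scale.
  by apply: Wpow; [apply: ltn_ord | apply: We].
have Wxi f : W i.+1 f -> W i.+1 (X i * f).
  apply: (span_image (lmul_linear _)) => _ [a [w [ai Ww ->]]].
  rewrite mulrA -exprS; case: (ltnP a.+1 (n - i)) => [?|ia]; first exact: Wpow.
  have -> : a.+1 = (n - i)%N by lia.
  apply: init_span_mul Wtop WxS _ Ww => j ji; rewrite -[X j]expr1.
  by apply: scomm_xvarX; lia.
split=> [j f|m].
  by rewrite ltnS leq_eqVlt => /orP [/eqP->|]; [apply: Wxi | apply: WxS].
elim: m => [|m IHm]; first by rewrite /tail_elsym elsym0; apply: init_span1.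
have -> : tail_elsym i.+1 m.+1 =
    - (-1) ^+ i *: (X i * tail_elsym i.+1 m) + tail_elsym i m.+1.
  by rewrite (tail_elsymS m i_n) /Y scaleNr -scalerAl addrC addrK.
by apply: init_span_lin; [apply: Wxi | apply: init_spanS].
Qed.

Lemma init_span_full f : init_span n f.
Proof.
have [Wx _] := init_span_closed (leqnn n).
elim/spol_ind: f => [|j f|c f g].
- exact: init_span1.
- by rewrite -xvarE; apply: Wx.
- exact: init_span_lin.
Qed.

(** The induction moves the factors of an element of init_span n one by one
    into a staircase monomial, until only an odd symmetric factor is left. *)
Lemma onc_faithful F : onc F ->
  (forall s, stair s -> size s = n -> F (rmon 0 s) = 0) -> forall f, F f = 0.
Proof.
move=> oF F0 f.
suff H i s w : (i + size s)%N = n -> stair s -> W i w -> F (rmon i s * w) = 0.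
  rewrite -[f]mul1r; apply: (H n [::]) => //; first by rewrite addn0.
  exact: init_span_full.
elim: i s w => [|i IH] s w isn ss.
  by move=> w0; rewrite onc_rlin // F0 ?mul0r.
elim=> {w} [_ [a [w [ai Ww ->]]]||c g h _ Fg _ Fh].
- rewrite mulrA; apply: (IH (a :: s)) => //=; first by rewrite addnS.
  by rewrite ss andbT; lia.
- by rewrite mulr0 raddf0.
- by rewrite mulrDr -scalerAr linearP Fg Fh scaler0 addr0.
Qed.

(** * Restriction to the staircase *)

Lemma onc_matrix_unit s t : stair s -> stair t -> size s = n -> size t = n ->
  exists2 F, onc F & matrix_unit 0 s t F.
Proof.
move=> ss st sn tn; case: (posnP n) => [n0|n_gt0].
  have nil (r : seq nat) : size r = n -> r = [::] by rewrite n0 => /size0nil.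
  exists 1 => [|u _]; first exact: gen_subalg_one.
  by rewrite tn => /nil ->; rewrite (nil s sn) (nil t tn).
have [|||F [oF _] uF] := matrix_units (d := n.-1) (i := 0) _ ss st;
  rewrite ?add0n ?prednK //.
by exists F.
Qed.

Lemma onc_zero : onc 0.
Proof.
by rewrite -(addNr 1) -scaleN1r; apply: gen_subalg_lin; apply: gen_subalg_one.
Qed.

(** A combination of the matrix units of one column: any value is reached at
    one monomial without changing the others. *)
Lemma onc_column t f : stair t -> size t = n -> Vspan 0 n f ->
  exists2 F, onc F & forall u, stair u -> size u = n ->
    F (rmon 0 u) = if u == t then f else 0.
Proof.
move=> st tn; elim=> {f} [_ [s [ss sn ->]]||c f g _ [F oF FE] _ [G oG GE]].
- have [F oF uF] := onc_matrix_unit ss st sn tn.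
  by exists F => // u su un; apply: uF; rewrite ?tn.
- by exists 0 => [|u _ _]; [apply: onc_zero | case: ifP].
- exists (c *: F + G) => [|u su un]; first exact: gen_subalg_lin.
  rewrite endo_addE endo_scaleE FE // GE //.
  by case: ifP => //; rewrite scaler0 addr0.
Qed.

Lemma stair_finite d :
  exists L : seq (seq nat), forall s, stair s -> size s = d -> s \in L.
Proof.
elim: d => [|d [L LP]]; first by exists [:: [::]] => -[].
exists [seq a :: s | a <- iota 0 d.+1, s <- L].
move=> [|a s] // /andP [a_s ss] [sd].
by apply: allpairs_f; [rewrite mem_iota; lia | apply: LP].
Qed.

(** Interpolation along an exhaustive list of exponents, one monomial at a
    time. *)
Lemma onc_dense (phi : seq nat -> S) :
    (forall t, stair t -> size t = n -> Vspan 0 n (phi t)) ->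
  exists2 F, onc F & forall t, stair t -> size t = n -> F (rmon 0 t) = phi t.
Proof.
move=> Vphi; have [L LP] := stair_finite n.
suff [F oF FE] : exists2 F, onc F &
    forall t, stair t -> size t = n -> t \in L -> F (rmon 0 t) = phi t.
  by exists F => // t st tn; apply: FE => //; apply: LP.
elim: L {LP} => [|t L [F oF FE]]; first by exists 0 => //; apply: onc_zero.
case: (boolP (stair t && (size t == n))) => [/andP [st /eqP tn]|tN]; last first.
  exists F => // u su un; rewrite inE => /orP [/eqP uE|]; last exact: FE.
  by rewrite -uE su un eqxx in tN.
(* F is corrected at t only. The correction also serves when t occurs again
   in L, since the value at t is then phi t already. *)
have Vd : Vspan 0 n (phi t - F (rmon 0 t)).
  apply: span_add; first exact: Vphi.
  by apply/span_opp/onc_stable/gen_submod_gen => //; exists t.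
have [G oG GE] := onc_column st tn Vd.
exists (F + G) => [|u su un].
  by rewrite -[F]scale1r; apply: gen_subalg_lin.
rewrite inE endo_addE GE //.
case: eqP => [->|_ /= uL]; first by rewrite addrC subrK.
by rewrite addr0 FE.
Qed.

Local Notation V := (Vn k n).
Local Notation A := (ONC k n).

Lemma onc_valP (f : A) : gen_subalg (@onc_gen k n) (\val f).
Proof. exact/asboolP/(valP f). Qed.

Lemma restr_subproof (f : A) (v : V) :
  (\val f) (\val v) \in stair_pred (k := k) (n := n).
Proof. exact/stair_predE/(onc_stable (onc_valP f))/stair_predE/(valP v). Qed.

Definition restr_fun (f : A) (v : V) : V := MkVn (restr_subproof f v).

Lemma restr_fun_linear (f : A) : linear (restr_fun f).
Proof. by move=> c u v; apply: val_inj; rewrite /= !linearP. Qed.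

Definition restr (f : A) : endo V := linear_of (restr_fun_linear f).

Lemma restrE (f : A) (v : V) : \val (restr f v) = (\val f) (\val v).
Proof. by []. Qed.

Lemma restr_linear : linear restr.
Proof. by move=> c f g; apply: linear_map_eq => v; apply: val_inj. Qed.

Lemma restr_monoid : monoid_morphism restr.
Proof. by split=> [|f g]; apply: linear_map_eq => v; apply: val_inj. Qed.

HB.instance Definition _ :=
  GRing.isLinear.Build k A (endo V) *:%R restr restr_linear.
HB.instance Definition _ :=
  GRing.isMonoidMorphism.Build A (endo V) restr restr_monoid.

Lemma rmon_stair s : stair s -> size s = n ->
  rmon 0 s \in stair_pred (k := k) (n := n).
Proof. by move=> ss sn; apply/stair_predE/gen_submod_gen; exists s. Qed.

Lemma restr_inj : injective restr.
Proof.
apply: raddf_inj => f f0; apply: val_inj; apply: linear_map_eq => g.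
apply: (onc_faithful (onc_valP f)) => s ss sn.
by rewrite -[rmon 0 s]/(\val (MkVn (rmon_stair ss sn))) -restrE f0.
Qed.

Lemma restr_surj (phi : endo V) : exists f : A, restr f = phi.
Proof.
pose psi s := if insub (rmon 0 s) is Some v then \val (phi v) else 0.
have [|F oF FE] := onc_dense (phi := psi).
  move=> t st tn; rewrite /psi insubT; first exact: rmon_stair.
  by move=> ?; apply/stair_predE/(valP (phi _)).
have oF' : F \in onc_subalg (k := k) (n := n) by apply/asboolP.
exists (MkONC oF'); apply: linear_map_eq => -[f Vf]; apply: val_inj.
rewrite restrE /=; have /stair_predE := Vf; move=> Sf.
elim: Sf Vf => {f} [_ [s [ss sn ->]]||c f g Sf Ff Sg Fg] V0.
- by rewrite FE // /psi insubT.
- by rewrite raddf0 (_ : MkVn V0 = 0) ?raddf0 //; apply: val_inj.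
- have [Vf Vg] := (proj2 (stair_predE f) Sf, proj2 (stair_predE g) Sg).
  rewrite (_ : MkVn V0 = c *: MkVn Vf + MkVn Vg); last exact: val_inj.
  by rewrite !linearP (Ff Vf) (Fg Vg).
Qed.

End OddNilCoxeter.

Theorem proposition4p9 (k : fieldType) (n : nat) :
  exists2 rho : {lrmorphism ONC k n -> endo (Vn k n)},
    (forall (f : ONC k n) (v : Vn k n), \val (rho f v) = (\val f) (\val v))
    & bijective rho.
Proof.
exists (@restr k n) => //.
have [g gK] := choice (@restr_surj k n).
by exists g => // f; apply: (@restr_inj k n); rewrite gK.
Qed.
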